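(* Let $V$ be a complex vector space of dimension $r+1$ with $r\ge 3$, and let $X\subseteq\mathbf{P}(V)=\mathbf{P}^r$ be a finite set of $d\ge r+1$ points in linear general position. Let $E=\Omega^1_{|V|}(\log\Sigma H_i)$ be the Dolgachev–Kapranov bundle on $|V|$ of the normal crossing arrangement of the $d$ hyperplanes $H_i\subseteq|V|$ dual to the points of $X$, and let $\mathrm{Vall\grave{e}s}(E)\subseteq\mathbf{P}(V)$ be its Vallès locus (which contains $X$). If $X\subsetneqq\mathrm{Vall\grave{e}s}(E)$, then $X$ lies on a rational normal curve in $\mathbf{P}(V)$.
   Context: Work over $\mathbf{C}$. $\mathbf{P}(V)$ is the projective space of one-dimensional quotients of $V$, and $|V|=\mathbf{P}(V^* )$ is the projective space of one-dimensional subspaces of $V$. A point of $\mathbf{P}(V)$ is the same as a codimension one subspace $W\subseteq V$, i.e. a hyperplane $|W|\subseteq|V|$. $\Omega^1_{|V|}(\log\Sigma H_i)$ is the bundle of one-forms with logarithmic poles along the arrangement. It is the Steiner bundle on $|V|$ determined by the map $\mu:H^1(\mathbf{P}(V),\mathcal{I}(1))^*\otimes V\to H^1(\mathbf{P}(V),\mathcal{I})^*$ deduced from multiplication $H^1(\mathbf{P}(V),\mathcal{I})\otimes V\to H^1(\mathbf{P}(V),\mathcal{I}(1))$, where $\mathcal{I}=\mathcal{I}_X\subseteq\mathcal{O}_{\mathbf{P}(V)}$ is the ideal sheaf of $X$; that is, with $U_1=H^1(\mathbf{P}(V),\mathcal{I}(1))^*$ and $U_0=H^1(\mathbf{P}(V),\mathcal{I})^*$,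 it is the cokernel of the map $U_1\otimes\mathcal{O}_{|V|}(-1)\to U_0\otimes\mathcal{O}_{|V|}$ obtained by composing $\mu$ with the tautological inclusion $\mathcal{O}_{|V|}(-1)\subseteq V\otimes\mathcal{O}_{|V|}$. The Vallès locus of a Steiner bundle $E$ on $|V|$ is the set $\mathrm{Vall\grave{e}s}(E)\subseteq\mathbf{P}(V)$ of all unstable planes, i.e. of all codimension one subspaces $W\subseteq V$ such that $H^0(|W|,E^*|_{|W|})\neq 0$ (equivalently, $E|_{|W|}$ has a trivial quotient). *)

(* Defs.v *)
From HB Require Import structures.
From mathcomp Require Import all_boot all_order all_algebra.
From mathcomp Require Import finmap mpoly generic_quotient ring_quotient.
From mathcomp Require Import sesquilinear ring.
From mathcomp Require Import boolp classical_sets functions reals complex.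

Set Warnings "-redundant-canonical-projection".

Set Implicit Arguments.
Unset Strict Implicit.
Unset Printing Implicit Defensive.

Import GRing.Theory.
Local Open Scope ring_scope.
Local Open Scope quotient_scope.

Section LinearAlgebra.
Variable F : fieldType.

Section Quotient.
Variables (M : lmodType F) (B : {pred M}) (hB : submod_closed B).

Definition submodule_of (_ : submod_closed B) : {pred M} := B.
HB.instance Definition _ := GRing.isSubmodClosed.Build F M (submodule_of hB) hB.

Definition lquot := Quotient.quot (submodule_of hB).
HB.instance Definition _ := GRing.Zmodule.on lquot.

Definition lproj (x : M) : lquot := \pi_(Quotient.quot (submodule_of hB)) x.

Definition lrepr (a : lquot) : M := repr (a : Quotient.quot (submodule_of hB)).

Lemma lreprK : cancel lrepr lproj.
Proof. exact: reprK. Qed.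

Lemma lproj_eq x y : (lproj x == lproj y) = (x - y \in B).
Proof. by rewrite /lproj -Quotient.idealrBE. Qed.

Lemma lprojP (P : lquot -> Prop) : (forall x, P (lproj x)) -> forall a, P a.
Proof. by move=> h a; rewrite -[a]lreprK. Qed.

Lemma lproj_add x y : lproj (x + y) = lproj x + lproj y.
Proof. by rewrite /lproj raddfD. Qed.

Definition lquot_scale (c : F) (a : lquot) : lquot := lproj (c *: lrepr a).

Lemma lquot_scaleE c x : lquot_scale c (lproj x) = lproj (c *: x).
Proof.
apply/eqP; rewrite /lquot_scale lproj_eq -scalerBr.
apply: (rpredZ c) (_ : _ \in submodule_of hB); rewrite -lproj_eq.
by rewrite lreprK.
Qed.

Lemma lquot_scaleA a b v :
  lquot_scale a (lquot_scale b v) = lquot_scale (a * b) v.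
Proof. by elim/lprojP: v => x; rewrite !lquot_scaleE scalerA. Qed.
Lemma lquot_scale1 : left_id 1 lquot_scale.
Proof. by elim/lprojP => x; rewrite lquot_scaleE scale1r. Qed.
Lemma lquot_scaleDr : right_distributive lquot_scale +%R.
Proof.
move=> c; elim/lprojP => x; elim/lprojP => y.
by rewrite -lproj_add !lquot_scaleE scalerDr lproj_add.
Qed.
Lemma lquot_scaleDl v : {morph lquot_scale^~ v : a b / a + b}.
Proof.
by move=> a b; elim/lprojP: v => x; rewrite !lquot_scaleE scalerDl lproj_add.
Qed.

HB.instance Definition _ := GRing.Zmodule_isLmodule.Build F lquot
  lquot_scaleA lquot_scale1 lquot_scaleDr lquot_scaleDl.

Lemma lproj_is_linear : linear lproj.
Proof. by move=> c x y; rewrite lproj_add -lquot_scaleE. Qed.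
HB.instance Definition _ := GRing.isLinear.Build F M lquot *:%R lproj
  lproj_is_linear.

End Quotient.

Section Dual.
Variable M : lmodType F.

Definition linear_form : {pred M -> F^o} := fun f => `[< linear f >].

Lemma linear_form_closed : submod_closed linear_form.
Proof.
split=> [|c f g /asboolP lf /asboolP lg]; apply/asboolP => a x y.
  by rewrite /= scaler0 addr0.
rewrite !fctE /= lf lg !scalerDr addrACA; congr (_ + _ + _).
by rewrite !scalerA mulrC.
Qed.
HB.instance Definition _ := GRing.isSubmodClosed.Build F (M -> F^o) linear_form
  linear_form_closed.

Record dual := Dual { dual_fun :> M -> F^o; _ : dual_fun \in linear_form }.
HB.instance Definition _ := [isSub for dual_fun].
HB.instance Definition _ := [Choice of dual by <:].
HB.instance Definition _ := [SubChoice_isSubLmodule of dual by <:].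

Lemma dual_is_linear (f : dual) : linear f.
Proof. by case: f => f /= /asboolP. Qed.
HB.instance Definition _ (f : dual) := GRing.isLinear.Build F M F^o *:%R f
  (dual_is_linear f).

End Dual.
End LinearAlgebra.

(* |T|, the projective space of one-dimensional subspaces of T, over an
   algebraically closed field. Its points are given by nonzero vectors of T, and
   sections of O(k) over an open subset are functions on the cone of that
   subset; only the values on the cone matter. *)
Section Projective.
Variables (F : closedFieldType) (T : vectType F).
Local Notation n := (\dim {:T}).

Definition xcoord (t : T) (i : 'I_n) : F := coord (vbasis {:T}) i t.

(* The cone over the intersection of the standard affine charts x_i <> 0,
   for i in I. *)
Definition chart (I : {set 'I_n}) (t : T) : bool :=
  [forall i in I, xcoord t i != 0].

(* Sections of O(k) over this intersection: the elements of degree k in the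
   localization of the coordinate ring at the product of the x_i, i in I. *)
Definition is_section (k : nat) (I : {set 'I_n}) (s : T -> F) : Prop :=
  exists m, exists2 P : {mpoly F[n]}, P \is (k + m * #|I|).-homog &
    forall t, chart I t -> s t = P.@[xcoord t] / (\prod_(i in I) xcoord t i) ^+ m.

Definition regular (s : T -> F) : Prop := forall i, is_section 0 [set i] s.

(* Sections of the k-th twist of the ideal sheaf of the (reduced) subset of |T|
   with cone Z. *)
Definition ideal_section (Z : set T) (k : nat) I (s : T -> F) : Prop :=
  is_section k I s /\ forall t, chart I t -> Z t -> s t = 0.

Lemma ideal_section_lin Z k I a s s' :
  ideal_section Z k I s -> ideal_section Z k I s' ->
  ideal_section Z k I (fun t => a * s t + s' t).
Proof.
move=> [[m [P hP sE]] s0] [[m' [P' hP' s'E]] s'0]; split; last first.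
  by move=> t It Zt; rewrite s0 // s'0 // mulr0 addr0.
pose Q : {mpoly F[n]} := \prod_(i in I) 'X_i.
have hQ : Q \is #|I|.-homog.
  rewrite /Q -sum1_card; elim/big_rec2: _ => [|i d q _ hq]; first exact: dhomog1.
  by apply: dhomogM => //; rewrite dhomogX; apply/eqP; exact: mdeg1.
have QE t : Q.@[xcoord t] = \prod_(i in I) xcoord t i.
  by rewrite /Q rmorph_prod /=; apply: eq_bigr => i _; rewrite mevalXU.
exists (m + m')%N, (a *: (P * Q ^+ m') + P' * Q ^+ m).
  apply: rpredD; first apply: rpredZ.
    have -> : (k + (m + m') * #|I| = k + m * #|I| + #|I| * m')%N.
      by rewrite mulnDl addnA (mulnC m').
    by apply: dhomogM => //; exact: dhomogMn.
  have -> : (k + (m + m') * #|I| = k + m' * #|I| + #|I| * m)%N.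
    by rewrite mulnDl (mulnC m) addnAC addnA.
  by apply: dhomogM => //; exact: dhomogMn.
move=> t It; rewrite sE // s'E // mevalD mevalZ !mevalM !rmorphXn /= QE.
have x0 : \prod_(i in I) xcoord t i != 0.
  by apply/prodf_neq0 => i iI; exact: (forall_inP It).
set x := \prod_(i in I) _ in x0 *.
have y0 e : x ^+ e != 0 by rewrite expf_neq0.
by rewrite exprD; field; rewrite !y0.
Qed.

Lemma ideal_section_mul Z k I (f : 'Hom(T, F^o)) s :
  ideal_section Z k I s -> ideal_section Z k.+1 I (fun t => f t * s t).
Proof.
move=> [[m [P hP sE]] s0]; split; last first.
  by move=> t It Zt; rewrite s0 // mulr0.
pose L : {mpoly F[n]} := \sum_(i < n) (f (vbasis {:T})`_i : F) *: 'X_i.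
have hL : L \is 1.-homog.
  apply: rpred_sum => i _; apply: rpredZ.
  by rewrite dhomogX; apply/eqP; exact: mdeg1.
exists m, (L * P); first by rewrite addSn -add1n; exact: dhomogM.
move=> t It; rewrite sE // mevalM mulrA; congr (_ * _ / _).
rewrite [in LHS](coord_vbasis (memvf t)) linear_sum /L rmorph_sum /=.
by apply: eq_bigr => i _; rewrite linearZ /= mevalZ mevalXU mulrC.
Qed.

Lemma chartU I J t : chart (I :|: J) t = chart I t && chart J t.
Proof.
apply/forall_inP/andP => [h|[/forall_inP hI /forall_inP hJ] i].
  by split; apply/forall_inP => i iI; apply: h; rewrite inE iI ?orbT.
by rewrite inE => /orP[/hI|/hJ].
Qed.

(* First Cech cohomology of the twisted ideal sheaf with respect to the standard
   affine cover of |T|. *)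
Section Cech.
Variables (Z : set T) (k : nat).

Definition cochain := 'I_n -> 'I_n -> T -> F^o.
HB.instance Definition _ := GRing.Lmodule.on cochain.

Definition is_cocycle (c : cochain) : Prop :=
  (forall i j, ideal_section Z k [set i; j] (c i j)) /\
  forall i j l t, chart [set i; j; l] t -> c j l t - c i l t + c i j t = 0.

(* A cochain that vanishes on the charts is a coboundary, so that the irrelevant
   values off the charts do not contribute to cohomology. *)
Definition is_coboundary (c : cochain) : Prop :=
  exists2 s : 'I_n -> T -> F, (forall i, ideal_section Z k [set i] (s i)) &
    forall i j t, chart [set i; j] t -> c i j t = s j t - s i t.

Definition cocycles : {pred cochain} := fun c => `[< is_cocycle c >].

Lemma ideal_section0 I : ideal_section Z k I (fun=> 0).
Proof.
split=> //; exists 0%N, 0; first exact: rpred0.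
by move=> t _; rewrite meval0 mul0r.
Qed.

Lemma cocycles_closed : submod_closed cocycles.
Proof.
split=> [|a c d /asboolP[hc zc] /asboolP[hd zd]]; apply/asboolP.
  split=> [i j|i j l t _]; first exact: ideal_section0.
  by change (0 - 0 + 0 = 0 :> F); rewrite subrr addr0.
split=> [i j|i j l t It]; first exact: ideal_section_lin.
change (a * c j l t + d j l t - (a * c i l t + d i l t)
  + (a * c i j t + d i j t) = 0).
have -> : a * c j l t + d j l t - (a * c i l t + d i l t)
  + (a * c i j t + d i j t)
  = a * (c j l t - c i l t + c i j t) + (d j l t - d i l t + d i j t) by ring.
by rewrite zc // zd // mulr0 addr0.
Qed.
HB.instance Definition _ := GRing.isSubmodClosed.Build F cochain cocycles
  cocycles_closed.

Record cocycle := Cocycle { cocycle_fun :> cochain; _ : cocycle_fun \in cocycles }.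
HB.instance Definition _ := [isSub for cocycle_fun].
HB.instance Definition _ := [Choice of cocycle by <:].
HB.instance Definition _ := [SubChoice_isSubLmodule of cocycle by <:].

Definition coboundaries : {pred cocycle} := fun c => `[< is_coboundary c >].

Lemma coboundaries_closed : submod_closed coboundaries.
Proof.
split=> [|a c d /asboolP[s hs cE] /asboolP[s' hs' dE]]; apply/asboolP.
  exists (fun _ _ => 0); first by move=> i; exact: ideal_section0.
  by move=> i j t _; rewrite subrr.
exists (fun i t => a * s i t + s' i t).
  by move=> i; exact: ideal_section_lin.
by move=> i j t It; rewrite opprD addrACA -mulrBr -cE // -dE.
Qed.
Definition H1 : lmodType F := lquot coboundaries_closed.

End Cech.
Arguments coboundaries Z k : clear implicits.

(* Multiplication H^1(I(k)) -> H^1(I(k+1)) by a linear form f on T, that is, by a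
   global section of O(1). *)
Section Multiplication.
Variables (Z : set T) (k : nat).

Definition mul_cochain (f : 'Hom(T, F^o)) (c : cochain) : cochain :=
  fun i j t => f t * c i j t.

Lemma mul_cocycle_subproof f (c : cocycle Z k) :
  mul_cochain f c \in cocycles Z k.+1.
Proof.
case: c => c /= /asboolP[hc zc]; apply/asboolP.
split=> [i j|i j l t It]; first exact: ideal_section_mul.
by rewrite /mul_cochain -mulrBr -mulrDr zc // mulr0.
Qed.
Definition mul_cocycle f c : cocycle Z k.+1 := Cocycle (mul_cocycle_subproof f c).

Definition mul_H1 (f : 'Hom(T, F^o)) (a : H1 Z k) : H1 Z k.+1 :=
  lproj (coboundaries_closed Z k.+1) (mul_cocycle f (lrepr a)).

Lemma mul_H1E f c :
  mul_H1 f (lproj (coboundaries_closed Z k) c) =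
  lproj (coboundaries_closed Z k.+1) (mul_cocycle f c).
Proof.
apply/eqP; rewrite /mul_H1 lproj_eq.
set c' := lrepr _.
have : c' - c \in coboundaries Z k by rewrite -(lproj_eq (coboundaries_closed Z k)) lreprK.
move=> /asboolP[s hs cE]; apply/asboolP; exists (fun i t => f t * s i t).
  by move=> i; exact: ideal_section_mul.
move=> i j t It; rewrite -mulrBr -cE //; exact: esym (mulrBr _ _ _).
Qed.

Lemma mul_H1_linearr f : linear (mul_H1 f).
Proof.
move=> b; elim/lprojP => c; elim/lprojP => d; rewrite -linearP !mul_H1E -linearP.
congr lproj; apply: val_inj; apply/funext => i; apply/funext => j.
apply/funext => t /=; rewrite /mul_cochain !fctE /= mulrDr; congr (_ + _).
exact: mulrCA.
Qed.

Lemma mul_H1_linearl a : linear (mul_H1^~ a).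
Proof.
elim/lprojP: a => c b f g; rewrite !mul_H1E -linearP.
congr lproj; apply: val_inj; apply/funext => i; apply/funext => j.
apply/funext => t /=; rewrite /mul_cochain !fctE /= add_lfunE scale_lfunE mulrDl.
by congr (_ + _); exact: esym (mulrA _ _ _).
Qed.

End Multiplication.
End Projective.

(* The Steiner bundle on |V| given by mu : U1 (x) V -> U0 is the cokernel of the
   induced map from U1 (x) O(-1) to U0 (x) O. *)
Record steiner (F : closedFieldType) (V : vectType F) := Steiner {
  st_U1 : lmodType F;
  st_U0 : lmodType F;
  st_mu : {bilinear st_U1 -> V -> st_U0}
}.

Section Steiner.
Variables (F : closedFieldType) (V : vectType F).

(* A section of E^* over |W| is a morphism to O from the cokernel E|_W of
   U1 (x) O(-1) -> U0 (x) O on |W|: an O-linear map U0 (x) O -> O, given by a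
   linear map s from U0 to regular functions on |W|, that is zero on the image
   mu(U1 (x) w) of the fibre of U1 (x) O(-1) at each point [w]. *)
Definition dual_section (E : steiner V) (W : {vspace V})
    (s : {linear st_U0 E -> (subvs_of W -> F^o)}) : Prop :=
  (forall u, regular (s u)) /\
  (forall u w, s (st_mu E u (vsval w)) w = 0).

(* H^0(|W|, E^*|_W) <> 0; the vector w = 0 is not a point of |W|. *)
Definition unstable (E : steiner V) (W : {vspace V}) : Prop :=
  exists2 s : {linear st_U0 E -> (subvs_of W -> F^o)},
    dual_section s & exists u w, w != 0 /\ s u w != 0.

(* Points of P(V) are codimension one subspaces of V. *)
Definition hyperplane : set {vspace V} := [set W | (\dim W).+1 = \dim {:V}].

Definition Valles (E : steiner V) : set {vspace V} :=
  [set W | hyperplane W /\ unstable E W].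

End Steiner.

(* P(V) is the space of lines in the dual of V: a nonzero p represents the point
   lker p, and v : V is the linear form p |-> p v. *)
Section DolgachevKapranov.
Variables (F : closedFieldType) (V : vectType F).
Local Notation V' := 'Hom(V, F^o).

Definition cone (X : set {vspace V}) : set V' := [set p | X (lker p)].

Definition evalv (v : V) (p : V') : F^o := p v.

Lemma evalv_is_linear v : linear (evalv v).
Proof. by move=> a p q; rewrite /evalv add_lfunE scale_lfunE. Qed.
HB.instance Definition _ v := GRing.isLinear.Build F V' F^o *:%R (evalv v)
  (evalv_is_linear v).

Definition ev (v : V) : 'Hom(V', F^o) := linfun (evalv v).

Lemma ev_is_linear : linear ev.
Proof.
move=> a v w; apply/lfunP => p; rewrite add_lfunE scale_lfunE !lfunE /=.
by rewrite /evalv linearP.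
Qed.
HB.instance Definition _ := GRing.isLinear.Build F V 'Hom(V', F^o) *:%R ev
  ev_is_linear.

Variable X : set {vspace V}.

Definition dk_U1 : lmodType F := dual (H1 (cone X) 1).
Definition dk_U0 : lmodType F := dual (H1 (cone X) 0).

Lemma dk_mu_subproof (u : dk_U1) v :
  (fun a : H1 (cone X) 0 => u (mul_H1 (ev v) a)) \in @linear_form F _.
Proof. by apply/asboolP => c a b; rewrite mul_H1_linearr linearP. Qed.

Definition dk_mu (u : dk_U1) (v : V) : dk_U0 := Dual (dk_mu_subproof u v).

Lemma dk_mu_linearl v : linear (dk_mu^~ v).
Proof. by move=> c u w; apply: val_inj; apply/funext. Qed.

Lemma dk_mu_linearr u : linear (dk_mu u).
Proof.
move=> c v w; apply: val_inj; apply/funext => a /=.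
by rewrite linearP mul_H1_linearl linearP.
Qed.

HB.instance Definition _ := bilinear_isBilinear.Build F dk_U1 V dk_U0 *:%R *:%R
  dk_mu (dk_mu_linearl, dk_mu_linearr).

Definition dolgachev_kapranov : steiner V := Steiner dk_mu.

End DolgachevKapranov.

Section Points.
Variables (F : fieldType) (V : vectType F).
Local Notation n := (\dim {:V}).

(* As hyperplanes of V, any k <= n points meet in codimension k; equivalently,
   the linear forms defining them are independent. *)
Definition linear_general_position (X : {fset {vspace V}}) : Prop :=
  forall Y : {fset {vspace V}}, (Y `<=` X)%fset -> (#|` Y| <= n)%N ->
    (\dim (\bigcap_(W <- Y) W)%VS + #|` Y|)%N = n.

(* The image of (s : t) |-> (s^r : s^(r-1) t : ... : t^r), r = n - 1, in the
   homogeneous coordinates on P(V) given by some basis of V. *)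
Definition rational_normal_curve (C : set {vspace V}) : Prop :=
  exists2 b : n.-tuple V, basis_of {:V} b &
    C = [set W | exists (s t : F) (p : 'Hom(V, F^o)),
      [/\ (s, t) != (0, 0), W = lker p &
          forall i : 'I_n, p b`_i = s ^+ (n.-1 - i) * t ^+ i]]%classic.

End Points.

(* Main.v *)
Require Import Defs.
From HB Require Import structures.
From mathcomp Require Import all_boot all_order all_algebra finmap mpoly ring.
From mathcomp Require Import boolp classical_sets reals complex.
From mathcomp Require Import fintype finset.

Set Implicit Arguments.
Unset Strict Implicit.
Unset Printing Implicit Defensive.

Import GRing.Theory.
Local Open Scope ring_scope.

(** Let p_1, ..., p_d be linear forms on V whose kernels are the points of X,
    and let n = r + 1 be the dimension of V.

    The ideal sheaf I of X has H^1(I(k)) = F^d / {(Q(p_1), ..., Q(p_d))}, where Q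
    runs over the forms of degree k, because H^0(O(k)) consists of forms
    (twist_H0) and H^1(O(k)) vanishes (twist_H1). The identification is the
    relation lifts between cohomology classes and vectors of values; it turns
    multiplication by v into coordinatewise multiplication by p_j(v)
    (lifts_mul). So U_0 is the space of vectors of sum zero, U_1 the space of
    linear relations b between the p_j, and mu(b, v) = (b_j p_j(v))_j.

    A regular function on the projective space |W| is constant, so an unstable W
    gives weights sigma_1, ..., sigma_d, not all equal, such that
    sum_j sigma_j b_j p_j vanishes on W for every relation b
    (unstable_weights).

    Suppose that W = ker q is not a point of X and that d >= n + 2. Take the
    basis e of V dual to the first n forms. The relation that expresses a further
    p_j through them gives p_j(e_i) (sigma_i - sigma_j) = lambda_j q(e_i) with
    lambda_j independent of i (weight_eq). General position makes the entries
    p_j(e_i) and the 2 x 2 minors of this matrix nonzero. Hence all q(e_i) are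
    nonzero, sigma_1, ..., sigma_n are distinct, and p_j is proportional to
    (q(e_i) / (sigma_i - tau))_i at tau = sigma_j. After clearing denominators
    this is a parametrization of a rational normal curve which passes through
    the i-th of the first n points at tau = sigma_i
    (rational_normal_curve_nodes). When d <= n + 1, the same curve with suitable
    parameters passes through X for every X in general position. *)

(** * Homogeneous polynomials and their values *)

Section MonomialShift.
Variables (n : nat) (R : comNzRingType).
Implicit Types (P : {mpoly R[n]}) (a b : 'I_n) (m e d : nat).

(** Division by the power x_b^m, where the monomials that it does not divide are
    dropped. It commutes with multiplication by the other variables, so it serves
    to cancel x_b^m in identities modulo powers of these. *)
Definition mshift b m P : {mpoly R[n]} :=
  \sum_(mu <- msupp P)
    (if (m <= mu b)%N then P@_mu *: 'X_[mu - U_(b) *+ m] else 0).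

Lemma lem_mnmU b m (mu : 'X_{1..n}) : (U_(b) *+ m <= mu)%MM = (m <= mu b)%N.
Proof.
apply/mnm_lepP/idP => [/(_ b)|h i]; rewrite mulmnE mnm1E.
  by rewrite eqxx mul1n.
by case: eqP => [<-|_]; rewrite ?mul1n ?mul0n //= leq0n.
Qed.

Lemma mcoeff_mshift b m P nu : (mshift b m P)@_nu = P@_(nu + U_(b) *+ m).
Proof.
rewrite /mshift raddf_sum /= [in RHS](mpolyE P) raddf_sum /=.
apply: eq_bigr => mu _; rewrite mcoeffZ mcoeffX -lem_mnmU.
case: ifP => h; last first.
  rewrite mcoeff0; case: eqP => [E|_]; last by rewrite mulr0.
  by rewrite E lem_addl in h.
rewrite mcoeffZ mcoeffX; congr (_ * _%:R).
by rewrite -[in RHS](submK h) eqm_add2r.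
Qed.

Lemma mcoeffMXn P a e nu :
  (P * 'X_a ^+ e)@_nu = if (e <= nu a)%N then P@_(nu - U_(a) *+ e) else 0.
Proof.
rewrite mpolyXn -lem_mnmU; case: ifP => [h|h].
  by rewrite -[in LHS](submK h) addmC mcoeffMX.
apply/eqP; rewrite mcoeff_eq0 (perm_mem (msuppMX _ _)); apply/negP.
by move=> /mapP[k _ E]; rewrite E lem_addr in h.
Qed.

Lemma mshiftMX b m P : mshift b m (P * 'X_b ^+ m) = P.
Proof.
apply/mpolyP => nu; rewrite mcoeff_mshift mcoeffMXn.
by rewrite -lem_mnmU lem_addl addmK.
Qed.

Lemma mshiftMXC a b m e P :
  a != b -> mshift b m (P * 'X_a ^+ e) = mshift b m P * 'X_a ^+ e.
Proof.
move=> ab; apply/mpolyP => nu; rewrite mcoeff_mshift !mcoeffMXn mcoeff_mshift.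
have -> : (nu + U_(b) *+ m)%MM a = nu a.
  by rewrite mnmDE mulmnE mnm1E eq_sym (negPf ab) mul0n addn0.
case: ifP => //; rewrite -lem_mnmU => h.
by rewrite ![(_ + U_(b) *+ m)%MM]addmC addmBA.
Qed.

Lemma mshiftB b m P Q : mshift b m (P - Q) = mshift b m P - mshift b m Q.
Proof. by apply/mpolyP => nu; rewrite mcoeffB !mcoeff_mshift mcoeffB. Qed.

Lemma mshift_homog b m d P :
  P \is (d + m).-homog -> mshift b m P \is d.-homog.
Proof.
move=> /dhomogP h; apply/dhomogP => nu; rewrite mcoeff_msupp mcoeff_mshift.
rewrite -mcoeff_msupp => /h; rewrite /= mdegD mdegMn mdeg1 mul1n.
exact: addIn.
Qed.

End MonomialShift.

Section HomogValues.
Variables (R : comNzRingType) (n : nat).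
Implicit Types (Q : {mpoly R[n]}) (x y : 'I_n -> R).

Lemma meval_homog k Q c x :
  Q \is k.-homog -> Q.@[fun i => c * x i] = c ^+ k * Q.@[x].
Proof.
move=> /dhomogP hQ; rewrite !mevalE mulr_sumr; apply: eq_big_seq => mu /hQ <-.
rewrite mulrCA; congr (_ * _); under eq_bigr do rewrite exprMn.
by rewrite big_split /= prodrXr -mdegE.
Qed.

Lemma meval_homog0 Q x y : Q \is 0.-homog -> Q.@[x] = Q.@[y].
Proof.
move=> hQ; have E z : Q.@[z] = Q.@[fun=> 0].
  have := meval_homog 0 z hQ; rewrite expr0 mul1r => <-.
  by apply: meval_eq => i; rewrite mul0r.
by rewrite !E.
Qed.

Lemma meval_homog1 Q x :
  Q \is 1.-homog -> Q.@[x] = \sum_i Q@_U_(i) * x i.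
Proof.
move=> /dhomogP hQ; have QE : Q = \sum_i Q@_U_(i) *: 'X_i.
  apply/mpolyP => mu; rewrite raddf_sum /=.
  under eq_bigr do rewrite mcoeffZ mcoeffX.
  have [/mdeg1P[i /eqP ->]|mu1] := boolP (mdeg mu == 1%N).
    rewrite (bigD1 i) //= eqxx mulr1 big1 ?addr0 // => j /negPf ji.
    by rewrite eq_mnm1 ji mulr0.
  rewrite memN_msupp_eq0 ?big1 // => [i _|].
    by case: eqP => [E|_]; rewrite ?mulr0 //; rewrite -E mdeg1 in mu1.
  by apply: contra mu1 => /hQ /eqP.
rewrite [Q in LHS]QE raddf_sum /=.
by apply: eq_bigr => i _; rewrite mevalZ mevalXU.
Qed.

End HomogValues.

Section PolynomialFunctions.
Variable F : closedFieldType.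

(** Evaluation in all variables is evaluation of the coefficients in all but the
    last one, followed by evaluation in the last; the induction on the number of
    variables in mpoly_nonroot rests on it. *)
Lemma meval_muni n (P : {mpoly F[n.+1]}) (x : 'I_n.+1 -> F) :
  (map_poly (meval (fun i => x (widen_ord (leqnSn n) i))) (muni P)).[x ord_max] =
  P.@[x].
Proof.
rewrite muniE mevalE rmorph_sum /= horner_sum; apply: eq_bigr => mu _.
rewrite -!mul_polyC !rmorphM /= !map_polyC /= !map_polyXn.
rewrite !hornerE mevalZ mevalX big_ord_recr /= mulrA; congr (_ * _ * _).
by apply: eq_bigr => i _; rewrite mnmE.
Qed.

Lemma mpoly_nonroot n (P : {mpoly F[n]}) : P != 0 -> exists x, P.@[x] != 0.
Proof.
elim: n P => [|n IH] P P0.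
  exists (fun=> 0); apply: contra P0 => /eqP h.
  by move: h; rewrite [P]nvar0_mpolyC mevalC => ->; rewrite mpolyC0.
have [k Qk] : exists k, (muni P)`_k != 0.
  have [mu Pmu] : exists mu, P@_mu != 0.
    have [/hasP[mu] _ h|/hasPn h] := boolP (has (fun mu => P@_mu != 0) (msupp P)).
      by exists mu.
    move: P0; rewrite [P]mpolyE big_seq big1 ?eqxx // => mu /h.
    by rewrite negbK => /eqP ->; rewrite scale0r.
  exists (mu ord_max); apply: contra Pmu => /eqP h.
  set nu : 'X_{1..n} := [multinom mu (widen_ord (leqnSn n) i) | i < n].
  have : (muni P)`_(mu ord_max)@_nu = 0 by rewrite h mcoeff0.
  rewrite muniE coef_sum raddf_sum /= [P in _ -> P@__ == 0]mpolyE raddf_sum /=.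
  move=> {2}<-; apply/eqP; apply: eq_bigr => ka _.
  rewrite mcoeffZ mcoeffX !coefZ coefXn -mul_mpolyC mulr_natr.
  rewrite mcoeffMn mcoeffCM mcoeffX mulr_natr mulr_natr -mulrnA mulnb.
  congr (_ *+ nat_of_bool _); apply/eqP/andP => [->|[/eqP/mnmP E /eqP Emax]].
    by rewrite !eqxx.
  apply/mnmP => i; case: (unliftP ord_max i) => [j|] -> //.
  have -> : lift ord_max j = widen_ord (leqnSn n) j.
    by apply: val_inj; rewrite /= /bump leqNgt ltn_ord.
  by have := E j; rewrite !mnmE.
have [x' hx'] := IH _ Qk.
have : map_poly (meval x') (muni P) != 0.
  apply: contra hx' => /eqP h; apply/eqP.
  by have := coef_map (meval x') (muni P) k; rewrite /= h coef0 => <-.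
move=> /closed_nonrootP[y /negP hy].
exists (fun i => if insub (val i) is Some j then x' j else y); apply/negP.
rewrite -meval_muni /= insubF ?ltnn // => h; apply: hy; move: h; rewrite /root.
congr (_.[_] == 0); apply: eq_map_poly => q; apply: meval_eq => i.
by rewrite valK.
Qed.

Lemma mpoly_fun0 n (P : {mpoly F[n]}) : (forall x, P.@[x] = 0) -> P = 0.
Proof.
move=> h; apply/eqP/negPn/negP => /mpoly_nonroot[x].
by rewrite h eqxx.
Qed.

End PolynomialFunctions.

(** * Sections of O(k) on intersections of standard charts *)

Section Sections.
Variables (F : closedFieldType) (T : vectType F).
Local Notation n := (\dim {:T}).
Implicit Types (I J : {set 'I_n}) (s h : T -> F) (k m : nat) (P : {mpoly F[n]}).

Lemma xcoord_surj (y : 'I_n -> F) : exists t : T, xcoord t =1 y.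
Proof.
exists (\sum_i y i *: (vbasis {:T})`_i) => i; rewrite /xcoord coord_sum_free //.
exact/basis_free/vbasisP.
Qed.

Lemma xcoordZ c (t : T) i : xcoord (c *: t) i = c * xcoord t i.
Proof. by rewrite /xcoord linearZ. Qed.

Lemma xcoord_neq0 (t : T) : t != 0 -> exists i, xcoord t i != 0.
Proof.
move=> t0; apply/existsP; apply: contraR t0 => /existsPn h.
rewrite (coord_vbasis (memvf t)) big1 // => i _.
by move: (h i); rewrite negbK /xcoord => /eqP ->; rewrite scale0r.
Qed.

Lemma chart0 (t : T) : chart set0 t.
Proof. by apply/forall_inP => i; rewrite inE. Qed.

Lemma chart1 i (t : T) : chart [set i] t = (xcoord t i != 0).
Proof.
apply/forall_inP/idP => [h|h j]; first by apply: h; rewrite inE.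
by rewrite inE => /eqP ->.
Qed.

Lemma chartU1 i I (t : T) : chart (i |: I) t = (xcoord t i != 0) && chart I t.
Proof. by rewrite chartU chart1. Qed.

Lemma chartZ c I (t : T) : c != 0 -> chart I (c *: t) = chart I t.
Proof.
move=> c0; apply: eq_forallb => i; congr (_ ==> _).
by rewrite xcoordZ mulf_eq0 (negPf c0).
Qed.

Lemma chartS I J (t : T) : I \subset J -> chart J t -> chart I t.
Proof. by move=> /subsetP IJ /forall_inP Jt; apply/forall_inP => i /IJ /Jt. Qed.

Definition prodX I : {mpoly F[n]} := \prod_(i in I) 'X_i.

Lemma prodX_homog I : prodX I \is #|I|.-homog.
Proof.
rewrite /prodX -sum1_card; elim/big_rec2: _ => [|i d q _ hq]; first exact: dhomog1.
by apply: dhomogM => //; rewrite dhomogX; apply/eqP; exact: mdeg1.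
Qed.

Lemma meval_prodX I x : (prodX I).@[x] = \prod_(i in I) x i.
Proof. by rewrite rmorph_prod /=; apply: eq_bigr => i _; rewrite mevalXU. Qed.

Lemma prodX_neq0 I (t : T) : chart I t -> \prod_(i in I) xcoord t i != 0.
Proof. by move=> /forall_inP It; apply/prodf_neq0. Qed.

(** P times the product of the x_i, i in I, vanishes everywhere, hence is zero. *)
Lemma mpoly_chart0 I P : (forall t, chart I t -> P.@[xcoord t] = 0) -> P = 0.
Proof.
move=> h; have : P * prodX I = 0.
  apply: mpoly_fun0 => x; have [t tx] := xcoord_surj x.
  rewrite -!(meval_eq _ tx) mevalM; have [It|It] := boolP (chart I t).
    by rewrite h ?mul0r.
  have [i iI ti] : exists2 i, i \in I & xcoord t i = 0.
    by move: It => /forall_inPn[i iI]; rewrite negbK => /eqP; exists i.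
  by rewrite meval_prodX (bigD1 i) //= ti mul0r mulr0.
move=> /eqP; rewrite mulf_eq0 => /orP[/eqP//|/prodf_eq0[i _]].
move=> /eqP/(congr1 (mcoeff U_(i))); rewrite mcoeffX eqxx mcoeff0 => /eqP.
by rewrite oner_eq0.
Qed.

Lemma is_section_ext k I s h :
  (forall t, chart I t -> s t = h t) -> is_section k I s -> is_section k I h.
Proof. by move=> sh [m [P hP sE]]; exists m, P => // t It; rewrite -sh ?sE. Qed.

Lemma is_section_lin k I a s h : is_section k I s -> is_section k I h ->
  is_section k I (fun t => a * s t + h t).
Proof.
move=> hs hh.
by have [] : ideal_section classical_sets.set0 k I (fun t => a * s t + h t);
  first exact: ideal_section_lin.
Qed.

Lemma is_section0 k I : is_section k I (fun=> 0 : F).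
Proof. by have [] := @ideal_section0 F T classical_sets.set0 k I. Qed.

Lemma is_sectionN k I s : is_section k I s -> is_section k I (fun t => - s t).
Proof.
move=> /(is_section_lin (-1))/(_ (is_section0 k I)).
by apply: is_section_ext => t _; rewrite mulN1r addr0.
Qed.

Lemma is_sectionD k I s h : is_section k I s -> is_section k I h ->
  is_section k I (fun t => s t + h t).
Proof.
move=> /(is_section_lin 1) hs /hs.
by apply: is_section_ext => t _; rewrite mul1r.
Qed.

Lemma is_sectionB k I s h : is_section k I s -> is_section k I h ->
  is_section k I (fun t => s t - h t).
Proof. by move=> hs hh; apply/is_sectionD/is_sectionN. Qed.

Lemma is_section_sum k I d (y : 'I_d -> F) (s : 'I_d -> T -> F) :
  (forall j, is_section k I (s j)) ->
  is_section k I (fun t => \sum_j y j * s j t).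
Proof.
move=> hs; rewrite /=; elim: (index_enum _) => [|j r IH].
  by apply: is_section_ext (is_section0 k I) => t _; rewrite big_nil.
apply: is_section_ext (is_section_lin (y j) (hs j) IH) => t _.
by rewrite big_cons.
Qed.

Lemma is_section_sub k I J s : I \subset J ->
  is_section k I s -> is_section k J s.
Proof.
move=> IJ [m [P hP sE]]; exists m, (P * prodX (J :\: I) ^+ m).
  have -> : (k + m * #|J| = k + m * #|I| + #|J :\: I| * m)%N.
    rewrite -addnA (mulnC #|_|) -mulnDr cardsD (setIidPr IJ).
    by rewrite subnKC ?subset_leq_card.
  by apply/dhomogM/dhomogMn/prodX_homog.
move=> t Jt; have It := chartS IJ Jt; have JIt := chartS (subsetDl J I) Jt.
rewrite sE // mevalM rmorphXn /= meval_prodX.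
rewrite (big_setID I (A := J)) /= (setIidPr IJ) exprMn invfM mulrACA.
by rewrite mulfV ?mulr1 // expf_neq0 // prodX_neq0.
Qed.

(** A denominator may be replaced by any higher power; this puts several sections
    over a common exponent. *)
Lemma is_section_raise k I s : is_section k I s ->
  exists m0, forall m, (m0 <= m)%N ->
  exists2 P : {mpoly F[n]}, P \is (k + m * #|I|).-homog &
    forall t, chart I t ->
    P.@[xcoord t] = s t * (\prod_(i in I) xcoord t i) ^+ m.
Proof.
move=> [m0 [P hP sE]]; exists m0 => m m0m; exists (P * prodX I ^+ (m - m0)).
  have -> : (k + m * #|I| = k + m0 * #|I| + #|I| * (m - m0))%N.
    by rewrite (mulnC #|I|) -addnA -mulnDl subnKC.
  by apply/dhomogM/dhomogMn/prodX_homog.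
move=> t It; rewrite sE // mevalM rmorphXn /= meval_prodX -[in RHS](subnKC m0m).
by rewrite exprD mulrA divfK // expf_neq0 // prodX_neq0.
Qed.

(** The identity theorem: the smaller chart is dense in the larger one. *)
Lemma is_section_dense k I J s : is_section k I s ->
  (forall t, chart (I :|: J) t -> s t = 0) -> forall t, chart I t -> s t = 0.
Proof.
move=> [m [P hP sE]] s0 t It; suff P0 : P = 0 by rewrite sE // P0 meval0 mul0r.
apply: (@mpoly_chart0 (I :|: J)) => u IJu; have := s0 u IJu.
move: IJu; rewrite chartU => /andP[Iu _]; rewrite sE // => /eqP.
by rewrite mulf_eq0 invr_eq0 (negPf (expf_neq0 _ (prodX_neq0 Iu))) orbF => /eqP.
Qed.

Lemma section_homog k I s c t : is_section k I s -> c != 0 -> chart I t ->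
  s (c *: t) = c ^+ k * s t.
Proof.
move=> [m [P hP sE]] c0 It; rewrite !sE ?chartZ //.
rewrite (meval_eq _ (xcoordZ c t)) (meval_homog _ _ hP).
under eq_bigr do rewrite xcoordZ.
rewrite big_split /= prodr_const exprD (mulnC m) exprM exprMn invfM.
by rewrite [_ * _ * P.@[_]]mulrAC mulrA mulfK ?mulrA // !expf_neq0.
Qed.

(** A Hartogs-type extension. If s = P / (x_I x_a)^m and h = Q / (x_I x_b)^m agree,
    then P x_b^m = Q x_a^m, so x_a^m divides P and it can be cancelled from the
    denominator. With I empty this computes the global sections. *)
Lemma is_section_glue k I (a b : 'I_n) s h : a != b ->
  is_section k (a |: I) s -> is_section k (b |: I) h ->
  (forall t, chart (a |: (b |: I)) t -> s t = h t) ->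
  exists2 g, is_section k I g &
    (forall t, chart (a |: I) t -> g t = s t) /\
    (forall t, chart (b |: I) t -> g t = h t).
Proof.
move=> ab hs hh sh; have [aI|aI] := boolP (a \in I).
  have aIE : a |: I = I by apply/setUidPr; rewrite sub1set.
  exists s; first by rewrite -aIE.
  split=> // t bIt; apply: sh.
  by rewrite chartU1 bIt andbT; move/forall_inP: bIt; apply; rewrite !inE aI orbT.
have [bI|bI] := boolP (b \in I).
  have bIE : b |: I = I by apply/setUidPr; rewrite sub1set.
  by exists h; [rewrite -bIE | split=> // t; rewrite bIE in sh *; move/sh].
have [m1 {}hs] := is_section_raise hs; have [m2 {}hh] := is_section_raise hh.
pose m := maxn m1 m2.
have [P hP sE] := hs m (leq_maxl _ _); have [Q hQ hE] := hh m (leq_maxr _ _).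
have PQ : P * 'X_b ^+ m = Q * 'X_a ^+ m.
  apply/eqP; rewrite -subr_eq0; apply/eqP.
  apply: (@mpoly_chart0 (a |: (b |: I))) => t abt.
  have /and3P[ta tb It] : [&& xcoord t a != 0, xcoord t b != 0 & chart I t].
    by rewrite -!chartU1.
  rewrite mevalB !mevalM !rmorphXn /= !mevalXU.
  rewrite sE ?chartU1 ?ta // hE ?chartU1 ?tb // sh // !big_setU1 //=.
  by rewrite !exprMn; ring.
pose G := mshift b m Q; have hG : G \is (k + m * #|I|).-homog.
  by apply: mshift_homog; move: hQ; rewrite cardsU1 bI mulnDr muln1 addnCA addnC.
have PE : P = G * 'X_a ^+ m by rewrite -mshiftMXC // -PQ mshiftMX.
exists (fun t => G.@[xcoord t] / (\prod_(i in I) xcoord t i) ^+ m).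
  by exists m, G.
have gs t : chart (a |: I) t ->
    G.@[xcoord t] / (\prod_(i in I) xcoord t i) ^+ m = s t.
  move=> aIt; have := sE t aIt; move: aIt; rewrite chartU1 => /andP[ta It].
  rewrite PE mevalM rmorphXn /= mevalXU big_setU1 //=.
  rewrite exprMn [LHS]mulrC mulrCA => /mulfI.
  move=> ->; first by rewrite mulfK // expf_neq0 // prodX_neq0.
  by rewrite expf_neq0.
split=> // t bIt; apply/eqP; rewrite -subr_eq0; apply/eqP.
apply: (@is_section_dense k (b |: I) [set a] (fun t => _ / _ - h t)) bIt.
  apply: is_sectionB.
    by apply: is_section_sub (subsetUr _ _) _; exists m, G.
  by exists m, Q => // u bIu; rewrite hE // mulfK // expf_neq0 // prodX_neq0.
move=> u; rewrite setUC => abu; rewrite gs ?sh ?subrr //.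
by move: abu; rewrite !chartU1 => /and3P[-> _ ->].
Qed.

End Sections.

(** * Cech cohomology of O(k) in degrees 0 and 1 *)

Section Cohomology.
Variables (F : closedFieldType) (T : vectType F).
Local Notation n := (\dim {:T}).
Implicit Types (I J : {set 'I_n}) (s h : T -> F) (k m : nat) (P : {mpoly F[n]}).

Lemma is_section_set0 k s : is_section k set0 s ->
  exists2 Q : {mpoly F[n]}, Q \is k.-homog & forall t, s t = Q.@[xcoord t].
Proof.
move=> [m [Q hQ sE]]; exists Q; first by rewrite cards0 muln0 addn0 in hQ.
by move=> t; rewrite sE ?chart0 // big_set0 expr1n divr1.
Qed.

Lemma twist_H0 k (h : 'I_n -> T -> F) : (1 < n)%N ->
  (forall i, is_section k [set i] (h i)) ->
  (forall i j t, chart [set i; j] t -> h i t = h j t) ->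
  exists2 Q : {mpoly F[n]}, Q \is k.-homog &
    forall i t, chart [set i] t -> h i t = Q.@[xcoord t].
Proof.
move=> n1 hs hh; pose a : 'I_n := Ordinal (ltnW n1); pose b : 'I_n := Ordinal n1.
have [|||g gs [ga gb]] := @is_section_glue F T k set0 a b (h a) (h b) isT.
- by rewrite setU0.
- by rewrite setU0.
- by move=> t; rewrite setU0; exact: hh.
have [Q hQ gQ] := is_section_set0 gs; exists Q => // i t it.
rewrite -gQ; apply/eqP; rewrite -subr_eq0; apply/eqP.
apply: (@is_section_dense _ _ k [set i] [set a] (fun t => h i t - g t)) it.
  by apply: is_sectionB => //; exact: is_section_sub (sub0set _) gs.
move=> u iau; rewrite ga ?(hh i a) ?subrr //.
by move: iau; rewrite chartU setU0 => /andP[].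
Qed.

Lemma regular_const s : (1 < n)%N -> regular s ->
  forall t u, t != 0 -> u != 0 -> s t = s u.
Proof.
move=> n1 hs t u t0 u0.
have [|//|Q hQ sE] := @twist_H0 0 (fun=> s) n1; first exact: hs.
have [i ti] := xcoord_neq0 t0; have [j uj] := xcoord_neq0 u0.
by rewrite (sE i) ?chart1 // (sE j) ?chart1 //; exact: meval_homog0.
Qed.

(** The cocycle relation reads x_z^m P_ab = x_b^m P_az - x_a^m P_bz. Division by
    x_z^m commutes with x_a and x_b, so it writes P_ab as a combination of x_a^m
    and x_b^m, that is, it separates the two denominators of sab. This is where a
    third variable is needed. *)
Lemma twist_split k (a b z : 'I_n) (sab saz sbz : T -> F) :
  a != b -> a != z -> b != z ->
  is_section k [set a; b] sab -> is_section k [set a; z] saz ->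
  is_section k [set b; z] sbz ->
  (forall t, chart [set a; b; z] t -> sbz t - saz t + sab t = 0) ->
  exists fa fb, [/\ is_section k [set a] fa, is_section k [set b] fb &
    forall t, chart [set a; b] t -> sab t = fb t - fa t].
Proof.
move=> ab az bz hab haz hbz coc.
have [m1 {}hab] := is_section_raise hab; have [m2 {}haz] := is_section_raise haz.
have [m3 {}hbz] := is_section_raise hbz.
pose m := maxn m1 (maxn m2 m3).
have [|Pab Hab abE] := hab m; first exact: leq_maxl.
have [|Paz Haz azE] := haz m; first by rewrite /m maxnCA leq_maxl.
have [|Pbz Hbz bzE] := hbz m; first by rewrite /m maxnA leq_maxr.
have prod2 (i j : 'I_n) t : i != j ->
    \prod_(l in [set i; j]) xcoord t l = xcoord t i * xcoord t j.
  by move=> ij; rewrite big_setU1 ?inE //= big_set1.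
have E : Pab * 'X_z ^+ m = Paz * 'X_b ^+ m - Pbz * 'X_a ^+ m.
  apply/eqP; rewrite -subr_eq0; apply/eqP.
  apply: (@mpoly_chart0 _ _ [set a; b; z]) => t abz; have := coc t abz.
  move: abz; rewrite !(chartU, chart1) => /andP[/andP[ta tb] tz].
  rewrite !mevalB !mevalM !rmorphXn /= !mevalXU.
  rewrite abE ?azE ?bzE ?(chartU, chart1) ?ta ?tb ?tz // !prod2 // !exprMn.
  by move=> /eqP; rewrite addrC addr_eq0 => /eqP ->; ring.
pose Qa := mshift z m Paz; pose Qb := mshift z m Pbz.
have PabE : Pab = Qa * 'X_b ^+ m - Qb * 'X_a ^+ m.
  by rewrite -(mshiftMX z m Pab) E mshiftB !mshiftMXC.
have card2 (i j : 'I_n) : i != j ->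
    (k + m * #|[set i; j]| = k + m * #|[set i]| + m)%N.
  by move=> ij; rewrite cards2 ij cards1 muln1 muln2 -addnn addnA.
have hQa : Qa \is (k + m * #|[set a]|).-homog.
  by apply: mshift_homog; rewrite -(card2 a z).
have hQb : Qb \is (k + m * #|[set b]|).-homog.
  by apply: mshift_homog; rewrite -(card2 b z).
exists (fun t => - (Qa.@[xcoord t] / (\prod_(i in [set a]) xcoord t i) ^+ m)).
exists (fun t => - (Qb.@[xcoord t] / (\prod_(i in [set b]) xcoord t i) ^+ m)).
split; [by apply: is_sectionN; exists m, Qa|by apply: is_sectionN; exists m, Qb|].
move=> t abt; have := abE t abt; move: abt; rewrite chartU !chart1 => /andP[ta tb].
rewrite PabE mevalB !mevalM !rmorphXn /= !mevalXU prod2 // !big_set1 exprMn => EE.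
have ta0 : xcoord t a ^+ m != 0 by rewrite expf_neq0.
have tb0 : xcoord t b ^+ m != 0 by rewrite expf_neq0.
apply: (mulIf (mulf_neq0 ta0 tb0)); rewrite -EE; field.
by rewrite ta0 tb0.
Qed.

(** Once c a b is split as fb - fa, the sections fa + c a j and fb + c b j agree,
    so they extend together over the chart of j. *)
Lemma twist_H1 k (c : 'I_n -> 'I_n -> T -> F) : (2 < n)%N ->
  (forall i j, is_section k [set i; j] (c i j)) ->
  (forall i j l t, chart [set i; j; l] t -> c j l t - c i l t + c i j t = 0) ->
  exists2 f : 'I_n -> T -> F, (forall i, is_section k [set i] (f i)) &
    forall i j t, chart [set i; j] t -> c i j t = f j t - f i t.
Proof.
move=> n2 hc coc; have n1 := ltnW n2; have n0 := ltnW n1.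
pose a : 'I_n := Ordinal n0; pose b : 'I_n := Ordinal n1.
pose z : 'I_n := Ordinal n2.
have [fa [fb [hfa hfb abE]]] := twist_split (isT : a != b) (isT : a != z)
  (isT : b != z) (hc a b) (hc a z) (hc b z) (coc a b z).
have /choice[f hf] : forall j, exists g, is_section k [set j] g /\
    forall t, chart [set a; j] t -> g t = fa t + c a j t.
  move=> j; have [|||g gs [ga _]] := @is_section_glue F T k [set j] a b
    (fun t => fa t + c a j t) (fun t => fb t + c b j t) isT.
  - by apply: is_sectionD => //; apply: is_section_sub hfa; rewrite subsetUl.
  - by apply: is_sectionD => //; apply: is_section_sub hfb; rewrite subsetUl.
  - move=> t; rewrite setUA => abj; have := coc a b j t abj.
    have /abE -> : chart [set a; b] t by apply: chartS abj; rewrite subsetUl.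
    by move=> /(canRL (addrK _))/(canRL (subrK _)) ->; ring.
  by exists g.
exists f => [i|i j t ijt]; first by case: (hf i).
apply/eqP; rewrite -subr_eq0; apply/eqP.
have [hi fi] := hf i; have [hj fj] := hf j.
apply: (@is_section_dense _ _ k [set i; j] [set a] (fun t => _ - (_ - _))) ijt.
  apply: is_sectionB => //; apply: is_sectionB.
    by apply: is_section_sub hj; rewrite subsetUr.
  by apply: is_section_sub hi; rewrite subsetUl.
move=> u; rewrite !chartU => /andP[/andP[iu ju] au].
rewrite fi ?fj ?chartU ?iu ?ju ?au //.
have := coc a i j u; rewrite !chartU iu ju au => /(_ isT).
by move=> /(canRL (addrK _))/(canRL (subrK _)) ->; ring.
Qed.

End Cohomology.

(** * First cohomology of the ideal sheaf of a finite set of points *)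

Section PointIdeal.
Variables (F : closedFieldType) (T : vectType F) (d : nat) (p : 'I_d -> T).
Variable Z : set T.
Local Notation n := (\dim {:T}).
Hypothesis n_gt2 : (2 < n)%N.
Hypothesis p_neq0 : forall j, p j != 0.
Hypothesis Zp : forall t, Z t <-> exists j c, c != 0 /\ t = c *: p j.

Implicit Types (k : nat) (y : 'I_d -> F).

Definition cech_class k (c : cocycle Z k) : H1 Z k :=
  lproj (coboundaries_closed Z k) c.

Lemma cech_class_is_linear k : linear (@cech_class k).
Proof. exact: lproj_is_linear. Qed.

Lemma cech_class_eq0 k (c : cocycle Z k) :
  is_coboundary Z k c -> cech_class c = 0.
Proof.
move=> hc; apply/eqP.
rewrite /cech_class -(raddf0 (lproj (coboundaries_closed Z k))).
by rewrite lproj_eq subr0; apply/asboolP.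
Qed.

Lemma coboundary_of_cech_class k (c : cocycle Z k) :
  cech_class c = 0 -> is_coboundary Z k c.
Proof.
move=> /eqP; rewrite /cech_class -(raddf0 (lproj (coboundaries_closed Z k))).
by rewrite lproj_eq subr0 => /asboolP.
Qed.

Lemma ideal_section_points k I s : is_section k I s ->
  (forall j, chart I (p j) -> s (p j) = 0) -> ideal_section Z k I s.
Proof.
move=> hs s0; split=> // t It /Zp[j [c [c0 tE]]]; rewrite tE in It *.
by rewrite chartZ // in It; rewrite (section_homog hs) // s0 // mulr0.
Qed.

Lemma Zpoint j : Z (p j).
Proof. by apply/Zp; exists j, 1; rewrite oner_neq0 scale1r. Qed.

(** The connecting homomorphism of 0 -> I(k) -> O(k) -> O_X(k) -> 0, as a relation:
    the class a is the image of the values y at the points p j. *)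
Definition lifts k (a : H1 Z k) y : Prop :=
  exists c : cocycle Z k, exists f : 'I_n -> T -> F,
  [/\ a = cech_class c, forall i, is_section k [set i] (f i),
      forall i l t, chart [set i; l] t -> cocycle_fun c i l t = f l t - f i t &
      forall i j, xcoord (p j) i != 0 -> f i (p j) = y j].

(** H^1(O(k)) = 0 makes every class the coboundary of sections of O(k), whose
    values at a point do not depend on the chart. *)
Lemma lifts_exists k a : exists y, @lifts k a y.
Proof.
pose c := lrepr a; have [hc coc] := asboolP _ (valP c).
have [f hf cE] := twist_H1 n_gt2 (fun i l => (hc i l).1) coc.
have /choice[i0 hi0] : forall j, exists i, xcoord (p j) i != 0.
  by move=> j; exact: xcoord_neq0.
exists (fun j => f (i0 j) (p j)), c, f; split=> //; first by rewrite [RHS]lreprK.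
move=> i j pji; have ch : chart [set i0 j; i] (p j).
  by rewrite chartU !chart1 hi0.
apply/eqP; rewrite -subr_eq0 -cE //; apply/eqP.
by apply: (hc _ _).2 => //; exact: Zpoint.
Qed.

Lemma lifts_lin k b a a' y y' : @lifts k a y -> lifts a' y' ->
  lifts (b *: a + a') (fun j => b * y j + y' j).
Proof.
move=> [c [f [-> hf cE fy]]] [c' [f' [-> hf' cE' fy']]].
exists (b *: c + c'), (fun i t => b * f i t + f' i t).
split=> [|i|i l t ilt|i j pji].
- by rewrite cech_class_is_linear.
- exact: is_section_lin.
- rewrite [LHS](_ : _ = b * cocycle_fun c i l t + cocycle_fun c' i l t) //.
  by rewrite cE // cE' //; ring.
- by rewrite fy // fy'.
Qed.

Lemma lifts0 k a : @lifts k a (fun=> 0) -> a = 0.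
Proof.
move=> [c [f [-> hf cE f0]]]; apply: cech_class_eq0; exists f => // i.
by apply: ideal_section_points => // j; rewrite chart1; exact: f0.
Qed.

(** The values of a coboundary come from a global section of O(k). *)
Lemma lifts_ker k y : @lifts k 0 y ->
  exists2 Q : {mpoly F[n]}, Q \is k.-homog & forall j, y j = Q.@[xcoord (p j)].
Proof.
move=> [c [f [/esym/coboundary_of_cech_class[s hs cs] hf cE fy]]].
have [||Q hQ QE] := @twist_H0 F T k (fun i t => f i t - s i t) (ltnW n_gt2).
- by move=> i; apply: is_sectionB (hf i) (hs i).1.
- move=> i l t ilt; have := cs i l t ilt; rewrite cE // => E.
  by rewrite -[f l t](subrK (f i t)) E; ring.
exists Q => // j; have [i pji] := xcoord_neq0 (p_neq0 j).
rewrite -(QE i) ?chart1 // fy // (hs i).2 ?subr0 ?chart1 //; exact: Zpoint.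
Qed.

Lemma cocycle_of_sections k (f : 'I_n -> T -> F) y :
  (forall i, is_section k [set i] (f i)) ->
  (forall i j, xcoord (p j) i != 0 -> f i (p j) = y j) ->
  (fun i l t => f l t - f i t : F^o) \in cocycles Z k.
Proof.
move=> hf fy; apply/asboolP; split=> [i l|i j l t _]; last by rewrite /=; ring.
apply: ideal_section_points => [|j].
  apply: is_sectionB.
    by apply: is_section_sub (hf l); rewrite subsetUr.
  by apply: is_section_sub (hf i); rewrite subsetUl.
by rewrite chartU !chart1 => /andP[pi pl]; rewrite !fy ?subrr.
Qed.

Lemma lifts_of_sections k (f : 'I_n -> T -> F) y :
  (forall i, is_section k [set i] (f i)) ->
  (forall i j, xcoord (p j) i != 0 -> f i (p j) = y j) ->
  exists a : H1 Z k, lifts a y.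
Proof.
move=> hf fy; pose c := Cocycle (cocycle_of_sections hf fy).
by exists (cech_class c), c, f; split.
Qed.

Lemma lifts_poly k (Q : {mpoly F[n]}) : Q \is k.-homog ->
  @lifts k 0 (fun j => Q.@[xcoord (p j)]).
Proof.
move=> hQ; exists 0, (fun=> fun t => Q.@[xcoord t]); split=> //.
- by rewrite /cech_class raddf0.
- move=> i; exists 0%N, Q; first by rewrite mul0n addn0.
  by move=> t _; rewrite expr0 divr1.
- by move=> i l t _; rewrite subrr.
Qed.

Lemma lifts_mul k (g : 'Hom(T, F^o)) a y :
  @lifts k a y -> lifts (mul_H1 g a) (fun j => g (p j) * y j).
Proof.
move=> [c [f [-> hf cE fy]]].
exists (mul_cocycle g c), (fun i t => g t * f i t); split.
- by rewrite /cech_class mul_H1E.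
- move=> i; suff [] : ideal_section classical_sets.set0 k.+1 [set i]
    (fun t => g t * f i t) by [].
  by apply: ideal_section_mul; split.
- move=> i l t ilt; rewrite [LHS](_ : _ = g t * cocycle_fun c i l t) //.
  by rewrite cE // mulrBr.
- by move=> i j pji; rewrite fy.
Qed.

(** The linear form g as a polynomial in the coordinates of T. *)
Definition form_mpoly (g : 'Hom(T, F^o)) : {mpoly F[n]} :=
  \sum_(i < n) (g (vbasis {:T})`_i : F) *: 'X_i.

Lemma form_mpoly_homog g : form_mpoly g \is 1.-homog.
Proof.
apply: rpred_sum => i _; apply: rpredZ.
by rewrite dhomogX; apply/eqP; exact: mdeg1.
Qed.

Lemma meval_form_mpoly g t : (form_mpoly g).@[xcoord t] = g t.
Proof.
rewrite [t in RHS](coord_vbasis (memvf t)) [RHS]linear_sum /form_mpoly rmorph_sum /=.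
by apply: eq_bigr => i _; rewrite [RHS]linearZ mevalZ mevalXU mulrC.
Qed.

Hypothesis p_sep : forall j l, j != l ->
  exists g : 'Hom(T, F^o), g (p j) = 1 /\ g (p l) = 0.

(** Product over l <> j of linear forms that separate p j from p l. *)
Lemma interpolation j : exists2 Q : {mpoly F[n]}, Q \is d.-1.-homog &
  forall l, Q.@[xcoord (p l)] = (l == j)%:R.
Proof.
have /choice[g hg] : forall l, exists g : 'Hom(T, F^o),
    l != j -> g (p j) = 1 /\ g (p l) = 0.
  move=> l; case: (eqVneq j l) => [_|/p_sep[g hg]]; first by exists 0.
  by exists g.
exists (\prod_(l | l != j) form_mpoly (g l)).
  have -> : d.-1 = \sum_(l < d | l != j) 1.
    by rewrite sum1_card cardC1 card_ord.
  elim/big_rec2: _ => [|l e q _ hq]; first exact: dhomog1.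
  by apply: dhomogM => //; exact: form_mpoly_homog.
move=> l; rewrite rmorph_prod /=; under eq_bigr do rewrite meval_form_mpoly.
case: eqVneq => [->|lj]; first by rewrite big1 // => i /hg[].
by rewrite (bigD1 l) //= (hg l lj).2 mul0r.
Qed.

(** The factor (x_i(p_j) / x_i)^m lowers the degree of the interpolating forms to k
    on the chart of i without changing their values at the points. *)
Lemma lifts_surj k y : (k < d)%N -> exists a, @lifts k a y.
Proof.
move=> kd; have /choice[Q hQ] : forall j, exists Q : {mpoly F[n]},
    Q \is d.-1.-homog /\ forall l, Q.@[xcoord (p l)] = (l == j)%:R.
  by move=> j; have [Q ? ?] := interpolation j; exists Q.
pose m := (d.-1 - k)%N; have dE : d.-1 = (k + m)%N.
  by rewrite /m subnKC // -ltnS prednK // (leq_ltn_trans (leq0n k)).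
apply: (@lifts_of_sections k (fun i t =>
  \sum_j y j * ((Q j).@[xcoord t] * (xcoord (p j) i / xcoord t i) ^+ m))).
  move=> i; apply: is_section_sum => j.
  exists m, (xcoord (p j) i ^+ m *: Q j).
    by rewrite cards1 muln1 -dE; apply: rpredZ; case: (hQ j).
  by move=> t _; rewrite mevalZ big_set1 exprMn exprVn mulrCA mulrA.
move=> i j pji; rewrite (bigD1 j) //= (hQ j).2 eqxx divff // expr1n !mulr1.
by rewrite big1 ?addr0 // => l /negPf lj; rewrite (hQ l).2 eq_sym lj mul0r mulr0.
Qed.

(** A vector b orthogonal to the values of all forms of degree k is a linear form on
    H^1(I(k)): pair b with any vector of values that lifts to the given class. *)
Lemma dual_H1 k (b : 'I_d -> F) :
  (forall Q : {mpoly F[n]}, Q \is k.-homog ->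
     \sum_j b j * Q.@[xcoord (p j)] = 0) ->
  exists u : dual (H1 Z k), forall a y, lifts a y -> u a = \sum_j b j * y j.
Proof.
move=> hb; have /choice[v hv] := @lifts_exists k.
have vE a y : lifts a y -> \sum_j b j * v a j = \sum_j b j * y j.
  move=> hy; have := lifts_lin (-1) (hv a) hy; rewrite scaleN1r addNr.
  move=> /lifts_ker[Q /hb + QE] => /eqP.
  under eq_bigr do rewrite -QE mulrDr mulrCA.
  by rewrite big_split /= -mulr_sumr mulN1r addrC subr_eq0 => /eqP.
have hu : (fun a : H1 Z k => \sum_j b j * v a j : F^o) \in @linear_form F _.
  apply/asboolP => c a a'; rewrite (vE _ _ (lifts_lin c (hv a) (hv a'))).
  under eq_bigr do rewrite mulrDr mulrCA.
  by rewrite big_split /= -mulr_sumr.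
by exists (Dual hu) => a y /vE.
Qed.

(** A linear form on H^1(I(k)) is determined by its values on the classes of the
    coordinate vectors, since the class zero is the only one that the values zero
    lift to. *)
Lemma dual_lifts k (u : dual (H1 Z k)) (e : 'I_d -> H1 Z k) a y :
  (forall j, lifts (e j) (fun l => (l == j)%:R)) -> lifts a y ->
  u a = \sum_j u (e j) * y j.
Proof.
move=> he hy; have hsum : lifts (\sum_j y j *: e j) y.
  have yE : y = (fun l => \sum_j y j * (l == j)%:R).
    apply/funext => l; rewrite (bigD1 l) //= eqxx mulr1 big1 ?addr0 //.
    by move=> j /negPf jl; rewrite eq_sym jl mulr0.
  rewrite [X in lifts _ X]yE.
  elim: (index_enum _) => [|j s IH].
    have := lifts_poly (dhomog0 F mdeg k); rewrite big_nil; congr (lifts _ _).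
    by apply/funext => l; rewrite big_nil meval0.
  rewrite big_cons; have := lifts_lin (y j) (he j) IH; congr (lifts _ _).
  by apply/funext => l; rewrite big_cons.
have := lifts_lin (-1) hy hsum; rewrite scaleN1r.
have -> : (fun j => -1 * y j + y j) = fun=> 0.
  by apply/funext => j; rewrite mulN1r addNr.
move=> /lifts0/eqP; rewrite addrC subr_eq0 => /eqP <-.
rewrite linear_sum; apply: eq_bigr => j _; rewrite linearZ; exact: mulrC.
Qed.

End PointIdeal.

(** * Hyperplanes and linear forms *)

Section LinearForms.
Variables (F : fieldType) (V : vectType F).
Implicit Types (p q : 'Hom(V, F^o)) (W : {vspace V}).

Lemma dim_dual : \dim {:'Hom(V, F^o)} = \dim {:V}.
Proof. by rewrite !dimvf; exact: muln1. Qed.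

(** Proportionality is tested at a vector v0 with p v0 <> 0, as v - (p v / p v0) v0
    lies in the kernel of p. *)
Lemma lker_subP p q : p != 0 -> (lker p <= lker q)%VS -> exists c, q = c *: p.
Proof.
move=> /lfunPn[v0]; rewrite lfunE /= => pv0 /subvP pq.
exists (q v0 / p v0); apply/lfunP => v; rewrite scale_lfunE.
have : v - (p v / p v0) *: v0 \in lker q.
  by apply: pq; rewrite memv_ker linearB linearZ /= [_ *: _]divfK ?subrr.
rewrite memv_ker linearB linearZ subr_eq0 => /eqP ->.
by change (p v / p v0 * q v0 = q v0 / p v0 * p v); field.
Qed.

Lemma lkerZ c p : c != 0 -> lker (c *: p) = lker p.
Proof.
move=> c0; apply/vspaceP => v; rewrite !memv_ker scale_lfunE.
by rewrite scaler_eq0 (negPf c0).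
Qed.

Lemma lker_eqP p q : p != 0 -> q != 0 -> lker p = lker q ->
  exists2 c, c != 0 & q = c *: p.
Proof.
move=> p0 q0 pq; have [|c qE] := @lker_subP p q p0; first by rewrite pq.
by exists c => //; apply: contra_neq q0 => c0; rewrite qE c0 scale0r.
Qed.

Lemma lker_sep p q : p != 0 -> q != 0 -> lker p <> lker q ->
  exists v, p v = 1 /\ q v = 0.
Proof.
move=> p0 q0 pq; have /subvPn[v qv] : ~~ (lker q <= lker p)%VS.
  apply/negP => /(lker_subP q0)[c pE]; apply: pq; rewrite pE lkerZ //.
  by apply: contra_neq p0 => c0; rewrite pE c0 scale0r.
rewrite !memv_ker in qv * => pv; exists ((p v)^-1 *: v).
by rewrite !linearZ /= (eqP qv) scaler0; split=> //; exact: mulVf.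
Qed.

Lemma memv_bigcap_seq (s : seq {vspace V}) v :
  (forall W, W \in s -> v \in W) -> v \in (\bigcap_(W <- s) W)%VS.
Proof.
move=> h; rewrite big_seq; elim/big_ind: _ => [|U W vU vW|W /h //].
  exact: memvf.
by rewrite memv_cap vU.
Qed.

End LinearForms.

(** The equation of W is the coordinate along any v0 outside W in the decomposition
    of V as the sum of the line of v0 and W. *)
Lemma hyperplane_lker (F : closedFieldType) (V : vectType F) (W : {vspace V}) :
  hyperplane W -> exists2 q : 'Hom(V, F^o), q != 0 & W = lker q.
Proof.
rewrite /hyperplane /= => dimW.
have /subvPn[v0 _ v0W] : ~~ (fullv <= W)%VS.
  by apply/negP => /dimvS; rewrite -dimW ltnn.
have v00 : v0 != 0 by apply: contraNneq v0W => ->; exact: mem0v.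
have cap0 : (<[v0]> :&: W = 0)%VS.
  apply/eqP; rewrite -subv0; apply/subvP => x /memv_capP[/vlineP[k ->] kW].
  have [->|k0] := eqVneq k 0; first by rewrite scale0r mem0v.
  by move: kW; rewrite rpredZeq (negPf k0) (negPf v0W).
have sumT : (<[v0]> + W = fullv)%VS.
  apply/eqP; rewrite eqEdim subvf dimv_disjoint_sum // dim_vline v00 -dimW.
  exact: leqnn.
pose f v : F^o := coord [tuple v0] ord0 (daddv_pi <[v0]> W v).
have f_lin : linear f by move=> a x y; rewrite /f !linearP.
pose fL := GRing.isLinear.Build F V F^o *:%R f f_lin.
pose f' : {linear V -> F^o} := HB.pack f fL.
have piE v : daddv_pi <[v0]> W v = f v *: v0.
  have : daddv_pi <[v0]> W v \in <<[tuple v0]>>%VS.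
    by rewrite span_seq1 memv_pi.
  by move=> /coord_span {1}->; rewrite big_ord1.
exists (linfun f').
  apply/lfunPn; exists v0; rewrite !lfunE /=; apply/eqP => f0.
  have := daddv_pi_id cap0 (memv_line v0); rewrite piE f0 scale0r => /esym/eqP.
  by rewrite (negPf v00).
apply/vspaceP => v; rewrite memv_ker lfunE /=.
have vE : daddv_pi <[v0]> W v + daddv_pi W <[v0]> v = v.
  by apply: daddv_pi_add; rewrite // sumT memvf.
apply/idP/eqP => [vW|f0]; last by rewrite -vE piE f0 scale0r add0r memv_pi.
have h : daddv_pi <[v0]> W v \in (<[v0]> :&: W)%VS.
  rewrite memv_cap memv_pi /= -(rpredDr _ (memv_pi W <[v0]> v)) vE //.
move: h; rewrite cap0 memv0 piE scaler_eq0 (negPf v00) orbF.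
by move/eqP.
Qed.

(** * The weights of an unstable hyperplane *)

Section Unstable.
Variables (F : closedFieldType) (V : vectType F) (d : nat).
Variables (p : 'I_d -> 'Hom(V, F^o)) (X : set {vspace V}).
Local Notation n := (\dim {:V}).
Hypothesis n_gt2 : (2 < n)%N.
Hypothesis d_gt1 : (1 < d)%N.
Hypothesis p_neq0 : forall j, p j != 0.
Hypothesis p_inj : injective (fun j => lker (p j)).
Hypothesis Xp : forall W, X W <-> exists j, W = lker (p j).

Lemma cone_points t : cone X t <-> exists j c, c != 0 /\ t = c *: p j.
Proof.
rewrite /cone /= Xp; split=> [[j tj]|[j [c [c0 ->]]]]; last first.
  by exists j; rewrite lkerZ.
have t0 : t != 0.
  have /lfunPn[v] := p_neq0 j; apply: contra_neq => t0.
  by rewrite [RHS]lfunE; apply/eqP; rewrite -memv_ker -tj memv_ker t0 lfunE.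
by have [c c0 ->] := lker_eqP (p_neq0 j) t0 (esym tj); exists j, c.
Qed.

Lemma dual_sum (M : lmodType F) m (c : 'I_m -> F) (u : 'I_m -> dual M) a :
  (\sum_j c j *: u j) a = \sum_j c j * u j a.
Proof. by elim/big_rec2: _ => // j x y _ <-. Qed.

(** A section of the dual bundle on |W| is a linear form sg on U_0, since regular
    functions are constant. U_0 is spanned by the differences u j of coordinate
    vectors, dual to e j - e j0, so sg is given by the weights sg (u j); were they
    all equal, sg would vanish on vectors of sum zero. *)
Lemma unstable_weights (W : {vspace V}) :
  hyperplane W -> unstable (dolgachev_kapranov X) W ->
  exists2 sigma : 'I_d -> F, (exists i j, sigma i != sigma j) &
    forall b : 'I_d -> F, \sum_j b j *: p j = 0 ->
    forall w, w \in W -> \sum_j sigma j * (b j * p j w) = 0.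
Proof.
move=> hW [s [sreg smu] [u0 [w0 [w0n0 su0]]]].
have dimW : (1 < \dim {:subvs_of W})%N.
  rewrite dimvf; move: hW n_gt2; rewrite /hyperplane /= => <-.
  by rewrite ltnS.
pose sg (u : dk_U0 X) : F := s u w0.
have sgE u w : w != 0 -> s u w = sg u.
  by move=> wn0; exact: (regular_const dimW (sreg u) wn0 w0n0).
have n2 : (2 < \dim {:'Hom(V, F^o)})%N by rewrite dim_dual.
have psep j l : j != l ->
    exists g : 'Hom('Hom(V, F^o), F^o), g (p j) = 1 /\ g (p l) = 0.
  move=> jl; have [|v [vj vl]] := lker_sep (p_neq0 j) (p_neq0 l).
    by move/p_inj; apply/eqP.
  by exists (ev v); rewrite !lfunE.
have d0 := ltnW d_gt1; pose j0 : 'I_d := Ordinal d0.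
have /choice[e he] : forall j, exists a : H1 (cone X) 0,
    lifts p a (fun l => (l == j)%:R).
  by move=> j; exact: (lifts_surj cone_points psep _ d0).
have /choice[u hu] : forall j, exists u : dk_U0 X, forall a y,
    lifts p a y -> u a = y j - y j0.
  move=> j; pose b l : F := (l == j)%:R - (l == j0)%:R.
  have bE (y : 'I_d -> F) : \sum_l b l * y l = y j - y j0.
    under eq_bigr do rewrite mulrBl.
    rewrite sumrB [X in X - _](bigD1 j) // [X in _ - X](bigD1 j0) //= !eqxx !mul1r.
    by rewrite !big1 ?addr0 // => l /negPf ->; rewrite mul0r.
  have [|u hu] := dual_H1 n2 p_neq0 cone_points (k := 0) (b := b).
    by move=> Q hQ; rewrite bE (meval_homog0 _ (xcoord (p j0)) hQ) subrr.
  by exists u => a y /hu ->.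
have sum0 (v : dk_U0 X) : \sum_j v (e j) = 0.
  have h1 : lifts p (0 : H1 (cone X) 0) (fun=> 1).
    have := lifts_poly p (cone X) (dhomog1 F mdeg).
    by congr (lifts _ _ _); apply/funext => j; rewrite meval1.
  have := dual_lifts cone_points v he h1; rewrite raddf0 => /esym.
  by under eq_bigr do rewrite mulr1.
have decomp (v : dk_U0 X) : v = \sum_j v (e j) *: u j.
  apply: val_inj; apply/funext => a /=; rewrite dual_sum.
  have [y hy] := lifts_exists n2 p_neq0 cone_points a.
  rewrite (dual_lifts cone_points v he hy).
  under [RHS]eq_bigr do rewrite (hu _ _ _ hy) mulrBr.
  by rewrite sumrB -mulr_suml sum0 mul0r subr0.
have sgD v : sg v = \sum_j v (e j) * sg (u j).
  rewrite /sg [v in LHS]decomp linear_sum /=.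
  by elim/big_rec2: _ => // j x y _ <-; rewrite linearZ.
exists (fun j => sg (u j)).
  apply: contrapT => h; move: su0; rewrite sgE // sgD.
  have sgj j : sg (u j) = sg (u j0).
    by apply/eqP/negPn/negP => sj; apply: h; exists j, j0.
  by under eq_bigr do rewrite sgj; rewrite -mulr_suml sum0 mul0r eqxx.
move=> b hb w wW; have [->|wn0] := eqVneq w 0.
  by rewrite big1 // => j _; rewrite linear0 !mulr0.
have [|ub hub] := dual_H1 n2 p_neq0 cone_points (k := 1) (b := b).
  move=> Q hQ; under eq_bigr do rewrite (meval_homog1 _ hQ) mulr_sumr.
  rewrite exchange_big big1 //= => i _; under eq_bigr do rewrite mulrCA.
  rewrite -mulr_sumr; suff -> : \sum_j b j * xcoord (p j) i = 0 by rewrite mulr0.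
  have : xcoord (\sum_j b j *: p j) i = 0 by rewrite hb /xcoord linear0.
  by rewrite /xcoord linear_sum => {2}<-; apply: eq_bigr => j _; rewrite linearZ.
have := smu ub (vsproj W w); rewrite vsprojK // sgE; last first.
  by apply: contra_neq wn0 => w'0; rewrite -(vsprojK wW) w'0 linear0.
rewrite sgD => {2}<-; apply: eq_bigr => j _.
rewrite mulrC; congr (_ * _).
rewrite [RHS](hub _ _ (lifts_mul (ev w) (he j))).
rewrite (bigD1 j) //= eqxx mulr1 big1 ?addr0 ?lfunE // => l /negPf ->.
by rewrite !mulr0.
Qed.

End Unstable.

(** * Rational normal curves through points in adapted coordinates *)

Section Lagrange.
Variables (F : fieldType) (n : nat) (sigma : 'I_n -> F).
Hypothesis sigma_inj : injective sigma.

Lemma poly_nodes0 (P : {poly F}) :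
  (size P <= n)%N -> (forall i, P.[sigma i] = 0) -> P = 0.
Proof.
move=> sP P0; apply: (@roots_geq_poly_eq0 _ _ (codom sigma)).
- by apply/allP => _ /codomP[i ->]; rewrite rootE P0.
- by rewrite map_inj_uniq ?enum_uniq.
- by rewrite size_codom card_ord.
Qed.

(** The numerator of the i-th Lagrange polynomial at the nodes sigma. *)
Definition node_prod i (x : F) := \prod_(k | k != i) (x - sigma k).

Lemma node_prod_neq0 i : node_prod i (sigma i) != 0.
Proof.
apply/prodf_neq0 => k ki; rewrite subr_eq0; apply: contra ki.
by move=> /eqP/sigma_inj ->.
Qed.

Lemma node_prod_eq0 i k : k != i -> node_prod i (sigma k) = 0.
Proof. by move=> ki; rewrite /node_prod (bigD1 k) //= subrr mul0r. Qed.

(** Lagrange interpolation of the monomial of degree l < n at n nodes. *)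
Lemma lagrange_expn l x : (l < n)%N ->
  \sum_i sigma i ^+ l * (node_prod i x / node_prod i (sigma i)) = x ^+ l.
Proof.
move=> ln; pose N i : {poly F} := \prod_(k | k != i) ('X - (sigma k)%:P).
have NE i y : (N i).[y] = node_prod i y.
  by rewrite horner_prod; apply: eq_bigr => k _; rewrite hornerXsubC.
pose P := \sum_i (sigma i ^+ l / node_prod i (sigma i)) *: N i.
have PE y : P.[y] = \sum_i sigma i ^+ l * (node_prod i y / node_prod i (sigma i)).
  rewrite horner_sum; apply: eq_bigr => i _.
  by rewrite hornerZ NE mulrAC mulrA.
suff E : P - 'X^l = 0 by rewrite -PE -[P](subrK 'X^l) E add0r hornerXn.
apply: poly_nodes0 => [|i].
  rewrite (leq_trans (size_polyD _ _)) // size_polyN size_polyXn geq_max ln andbT.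
  apply: (leq_trans (size_sum _ _ _)); apply/bigmax_leqP => i _.
  apply: (leq_trans (size_scale_leq _ _)); rewrite /N -big_filter size_prod_XsubC.
  have [r _ _ [_ ->]] := big_enumP.
  by rewrite cardC1 card_ord prednK // (leq_ltn_trans (leq0n l)).
rewrite hornerD hornerN hornerXn PE (bigD1 i) //= divff ?node_prod_neq0 //.
rewrite mulr1 big1 ?addr0 ?subrr // => k ki.
by rewrite node_prod_eq0 1?eq_sym // mul0r mulr0.
Qed.

End Lagrange.

Section RationalNormalCurve.
Variables (F : fieldType) (V : vectType F).
Local Notation n := (\dim {:V}).
Variables (e : 'I_n -> V) (q : 'I_n -> 'Hom(V, F^o)) (sigma m : 'I_n -> F).
Hypothesis sigma_inj : injective sigma.
Hypothesis m_neq0 : forall i, m i != 0.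
Hypothesis qe : forall i k, q i (e k) = (i == k)%:R.

(** The basis for which the form with coordinates m i * node_prod sigma i tau takes
    the value tau^l at the l-th vector, by Lagrange interpolation. *)
Let b (l : 'I_n) : V :=
  \sum_i (sigma i ^+ l / (m i * node_prod sigma i (sigma i))) *: e i.

Let qb i l : q i (b l) = sigma i ^+ l / (m i * node_prod sigma i (sigma i)).
Proof.
rewrite /b linear_sum (bigD1 i) //= linearZ /= qe eqxx big1 ?addr0 => [|k ki].
  exact: mulr1.
by rewrite linearZ /= qe eq_sym (negPf ki) scaler0.
Qed.

Let b_basis : basis_of {:V} [tuple b l | l < n].
Proof.
rewrite basisEfree subvf size_tuple leqnn !andbT; apply/freeP => c c0 l.
pose P := \poly_(l < n) (if insub l is Some i then c i else 0).
have PE l' : P`_(nat_of_ord l') = c l' by rewrite coef_poly ltn_ord valK.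
rewrite -PE (_ : P = 0) ?coef0 //.
apply: (poly_nodes0 sigma_inj (size_poly _ _)) => i.
have w0 := mulf_neq0 (m_neq0 i) (node_prod_neq0 sigma_inj i).
have := congr1 (q i) c0; rewrite linear0 linear_sum => E.
apply: (mulIf (invr_neq0 w0)); rewrite mul0r -[RHS]E.
rewrite horner_poly mulr_suml; apply: eq_bigr => k _.
rewrite -tnth_nth tnth_mktuple linearZ /= qb valK.
exact: esym (mulrA _ _ _).
Qed.

(** Up to the factor prod_k (tau - sigma k), the coordinates m i * node_prod i tau
    are m i / (tau - sigma i); the cleared form also covers tau = sigma i, where it
    is a multiple of the i-th coordinate form. *)
Lemma rational_normal_curve_nodes :
  exists2 C, rational_normal_curve C &
    forall (p : 'Hom(V, F^o)) tau c, c != 0 ->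
      (forall i, c * p (e i) = m i * node_prod sigma i tau) -> C (lker p).
Proof.
eexists; first by exists [tuple b l | l < n]; [exact: b_basis | reflexivity].
move=> p tau c c0 pE; exists 1, tau, (c *: p); split.
- by rewrite xpair_eqE oner_eq0.
- by rewrite lkerZ.
move=> l; rewrite -tnth_nth tnth_mktuple expr1n mul1r -(lagrange_expn sigma_inj) //.
rewrite scale_lfunE /b linear_sum scaler_sumr; apply: eq_bigr => i _.
rewrite linearZ; apply: (etrans (mulrCA _ _ _)); rewrite pE.
have N0 := node_prod_neq0 sigma_inj i; set N := node_prod sigma i _ in N0 *.
by field; rewrite ?N0 ?m_neq0 ?N0.
Qed.

End RationalNormalCurve.

(** * From weights to a rational normal curve *)

Section GeneralPosition.
Variables (F : closedFieldType) (V : vectType F) (d : nat).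
Local Notation n := (\dim {:V}).
Variable p : 'I_d -> 'Hom(V, F^o).
Hypothesis p_neq0 : forall j, p j != 0.
Hypothesis n_le_d : (n <= d)%N.
Hypothesis general_position : forall (J : {set 'I_d}) v,
  #|J| = n -> {in J, forall j, p j v = 0} -> v = 0.

Local Notation iota := (widen_ord n_le_d).

Lemma widen_inj : injective iota.
Proof. by move=> i k /(congr1 val) /= /val_inj. Qed.

(** The first n forms have no common zero, so they are coordinates on V. *)
Lemma dual_basis : exists e : 'I_n -> V,
  (forall i k, p (iota i) (e k) = (i == k)%:R) /\
  (forall v, v = \sum_i (p (iota i) v : F) *: e i).
Proof.
pose f : V -> 'rV[F]_n := fun v => \row_i p (iota i) v.
have f_lin : linear f.
  by move=> a v w; apply/rowP => i; rewrite !mxE linearP.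
pose fL := GRing.isLinear.Build F V 'rV[F]_n *:%R f f_lin.
pose f' : {linear V -> 'rV[F]_n} := HB.pack f fL.
have fE i v : (linfun f' v) 0 i = p (iota i) v by rewrite lfunE /= mxE.
have inj0 v : (forall i, p (iota i) v = 0) -> v = 0.
  move=> v0; apply: (general_position (J := [set iota i | i in 'I_n])).
    by rewrite card_imset ?card_ord //; exact: widen_inj.
  by move=> _ /imsetP[i _ ->].
have ker0 : lker (linfun f') == 0%VS.
  rewrite -subv0; apply/subvP => v; rewrite memv_ker memv0 => /eqP fv0.
  by apply/eqP/inj0 => i; rewrite -fE fv0 mxE.
have full : limg (linfun f') = fullv.
  apply/eqP; rewrite eqEdim subvf /= limg_dim_eq ?(eqP ker0) ?capv0 //.
  have -> : \dim {:'rV[F]_n} = n by rewrite [LHS]dimvf; exact: mul1n.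
  exact: leqnn.
pose e k := ((linfun f')^-1)%VF (delta_mx 0 k).
have pe i k : p (iota i) (e k) = (i == k)%:R.
  by rewrite -fE limg_lfunVK ?full ?memvf // mxE eqxx.
exists e; split=> // v; apply/eqP; rewrite -subr_eq0; apply/eqP/inj0 => i.
rewrite linearB linear_sum (bigD1 i) //= linearZ /= pe eqxx.
rewrite big1 => [|k ki]; last by rewrite linearZ /= pe eq_sym (negPf ki) scaler0.
by rewrite addr0 [_ *: _]mulr1 subrr.
Qed.

Variable e : 'I_n -> V.
Hypothesis pe : forall i k, p (iota i) (e k) = (i == k)%:R.
Hypothesis e_span : forall v, v = \sum_i (p (iota i) v : F) *: e i.

Lemma iota_or (j : 'I_d) : (exists i, j = iota i) \/ (n <= j)%N.
Proof.
case: (ltnP j n) => [jn|]; [left|by right].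
by exists (Ordinal jn); exact: val_inj.
Qed.

Lemma iota_neq (j : 'I_d) i : (n <= j)%N -> iota i != j.
Proof. by move=> nj; apply: contraTneq nj => <-; rewrite -ltnNge /= ltn_ord. Qed.

(** Otherwise e i would be killed by p j and by the coordinate forms other than the
    i-th, which are n points in general position. *)
Lemma coord_neq0 (j : 'I_d) i : (n <= j)%N -> p j (e i) != 0.
Proof.
move=> nj; apply/eqP => pji.
have : e i = 0.
  apply: (general_position (J := j |: [set iota k | k in [set~ i]])).
    rewrite cardsU1 card_imset; last exact: widen_inj.
    rewrite cardsC1 card_ord; case: imsetP => [[k _ /eqP]|_].
      by rewrite eq_sym (negPf (iota_neq _ nj)).
    by rewrite /= add1n prednK // (leq_ltn_trans (leq0n i)).
  move=> l; rewrite !inE => /orP[/eqP -> //|/imsetP[k + ->]].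
  by rewrite !inE pe => /negPf ->.
by move=> ei; have := pe i i; rewrite ei linear0 eqxx => /esym/eqP; rewrite oner_eq0.
Qed.

(** Otherwise p j (e k) e i - p j (e i) e k would be killed by p j, p l and the
    coordinate forms other than the i-th and the k-th. *)
Lemma minor_neq0 (j l : 'I_d) i k : (n <= j)%N -> (n <= l)%N -> j != l -> i != k ->
  p j (e i) * p l (e k) != p j (e k) * p l (e i).
Proof.
move=> nj nl jl ik; apply/eqP => E; pose v := p j (e k) *: e i - p j (e i) *: e k.
have pv h : p h v = p j (e k) * p h (e i) - p j (e i) * p h (e k) :> F.
  by rewrite /v linearB; congr (_ - _); exact: linearZ.
have : v = 0.
  apply: (general_position (J := j |: (l |: [set iota h | h in ~: [set i; k]]))).
    rewrite cardsU1 cardsU1 card_imset; last exact: widen_inj.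
    rewrite !inE (negPf jl) /=; case: imsetP => [[h _ /eqP]|_].
      by rewrite eq_sym (negPf (iota_neq _ nj)).
    case: imsetP => [[h _ /eqP]|_].
      by rewrite eq_sym (negPf (iota_neq _ nl)).
    by have := cardsC [set i; k]; rewrite cards2 ik card_ord.
  move=> h; rewrite !inE pv => /or3P[/eqP->|/eqP->|/imsetP[g + ->]].
  - by ring.
  - by rewrite E; ring.
  - by rewrite !inE !pe negb_or => /andP[/negPf -> /negPf ->]; rewrite !mulr0 subrr.
move=> /(congr1 (p (iota i))); rewrite linear0 pv !pe eqxx (negPf ik).
by rewrite mulr1 mulr0 subr0 => /eqP; exact/negP/coord_neq0.
Qed.

Lemma exists_distinct N : exists s : 'I_N -> F, injective s /\ forall i, s i != 0.
Proof.
have [s us sN] : exists2 s : seq F, uniq (0 :: s) & size s = N.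
  elim: N => [|N [s us sN]]; first by exists [::].
  have : \prod_(a <- 0 :: s) ('X - a%:P) != 0 by apply/monic_neq0/monic_prod_XsubC.
  move=> /closed_nonrootP[x]; rewrite root_prod_XsubC inE negb_or => /andP[x0 xs].
  exists (x :: s); last by rewrite /= sN.
  by move: us => /=; rewrite inE negb_or eq_sym x0 xs => /andP[-> ->].
move: us => /= /andP[s0 us]; exists (fun i => nth 0 s i); split=> [i k /eqP|i].
  by rewrite nth_uniq ?sN // => /eqP/val_inj.
by apply: contraNneq s0 => <-; rewrite mem_nth ?sN.
Qed.

(** The shape in which points enter: p j is a multiple of the form with coordinates
    m i / (sigma i - tau). *)
Lemma rational_normal_curve_pencil (sigma m : 'I_n -> F) : injective sigma ->
  (forall i, m i != 0) ->
  (forall j : 'I_d, (n <= j)%N -> exists tau lambda, lambda != 0 /\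
    forall i, p j (e i) * (sigma i - tau) = lambda * m i) ->
  exists2 C, rational_normal_curve C & forall j, C (lker (p j)).
Proof.
move=> si m0 hj.
have [C hC CP] := rational_normal_curve_nodes si m0 pe.
exists C => // j; have [[i ->]|nj] := iota_or j.
  apply: (CP _ (sigma i) (m i * node_prod sigma i (sigma i))).
    by rewrite mulf_neq0 ?node_prod_neq0.
  move=> k; rewrite pe; case: eqVneq => [->|ik]; first by rewrite mulr1.
  by rewrite (node_prod_eq0 sigma ik) !mulr0.
have [tau [la [la0 E]]] := hj j nj.
have st i : sigma i - tau != 0.
  have : la * m i != 0 by rewrite mulf_neq0.
  by rewrite -E mulf_eq0 negb_or => /andP[].
apply: (CP _ tau (- la^-1 * \prod_k (tau - sigma k))).
  rewrite mulf_neq0 ?oppr_eq0 ?invr_eq0 //; apply/prodf_neq0 => k _.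
  by rewrite -oppr_eq0 opprB.
move=> i; apply: (mulIf (st i)); rewrite -mulrA E (bigD1 i) //= -/(node_prod _ _ _).
by field.
Qed.

(** The only condition comes from one extra point p l, if any: it is met at tau = 0
    with m i = p l (e i) * s i, for arbitrary distinct nonzero nodes s. *)
Lemma rational_normal_curve_few : (d <= n.+1)%N ->
  exists2 C, rational_normal_curve C & forall j, C (lker (p j)).
Proof.
move=> dn; have [s [s_inj s0]] := exists_distinct n.
have [nd|nd] := ltnP n d; last first.
  apply: (rational_normal_curve_pencil (m := fun=> 1) s_inj) => [i|j nj].
    exact: oner_neq0.
  by have := leq_trans (ltn_ord j) nd; rewrite ltnNge nj.
pose l := Ordinal nd.
apply: (rational_normal_curve_pencil (m := fun i => p l (e i) * s i) s_inj)
  => [i|j nj].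
  by rewrite mulf_neq0 // coord_neq0.
exists 0, 1; split=> [|i]; first exact: oner_neq0.
have -> : j = l.
  by apply: val_inj; apply/eqP; rewrite eqn_leq nj -ltnS (leq_trans (ltn_ord j)).
by rewrite subr0 mul1r.
Qed.

Lemma form_ext (g h : 'Hom(V, F^o)) : (forall i, g (e i) = h (e i)) -> g = h.
Proof.
move=> gh; apply/lfunP => v; rewrite (e_span v) !linear_sum.
by apply: eq_bigr => i _; rewrite !linearZ /= gh.
Qed.

Lemma form_coord (g : 'Hom(V, F^o)) v : g v = \sum_i g (e i) * p (iota i) v.
Proof.
rewrite [v in LHS]e_span linear_sum; apply: eq_bigr => i _.
by rewrite linearZ; exact: mulrC.
Qed.

Section Weights.
Variables (sigma : 'I_d -> F) (q : 'Hom(V, F^o)).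
Hypothesis sigma_nonconst : exists i j, sigma i != sigma j.
Hypothesis q_neq0 : q != 0.
Hypothesis q_new : forall j, lker q <> lker (p j).
Hypothesis q_weights : forall b : 'I_d -> F, \sum_j b j *: p j = 0 ->
  forall w, w \in lker q -> \sum_j sigma j * (b j * p j w) = 0.

(** Apply the weights to the relation between p j and the coordinate forms: the
    form g below vanishes on the kernel of q. *)
Lemma weight_eq (j : 'I_d) : (n <= j)%N ->
  exists la, forall i, p j (e i) * (sigma (iota i) - sigma j) = la * q (e i).
Proof.
move=> nj; pose b l : F := \sum_i p j (e i) * (l == iota i)%:R - (l == j)%:R.
have bE (G : 'I_d -> F) : \sum_l b l * G l = \sum_i p j (e i) * G (iota i) - G j.
  under eq_bigr do rewrite mulrBl mulr_suml.
  rewrite sumrB exchange_big /=; congr (_ - _).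
    apply: eq_bigr => i _; rewrite (bigD1 (iota i)) //= eqxx mulr1.
    by rewrite big1 ?addr0 // => l /negPf ->; rewrite mulr0 mul0r.
  rewrite (bigD1 j) //= eqxx mul1r.
  by rewrite big1 ?addr0 // => l /negPf ->; rewrite mul0r.
have b0 : \sum_l b l *: p l = 0.
  apply/lfunP => v; rewrite sum_lfunE lfunE /=.
  under eq_bigr do rewrite scale_lfunE.
  by rewrite [LHS]bE (form_coord (p j)) subrr.
pose g : 'Hom(V, F^o) :=
  \sum_i (p j (e i) * (sigma (iota i) - sigma j)) *: p (iota i).
have gE v : g v = \sum_i p j (e i) * (sigma (iota i) - sigma j) * p (iota i) v.
  by rewrite sum_lfunE; apply: eq_bigr => i _; rewrite scale_lfunE.
have [|la gq] := @lker_subP _ _ q g q_neq0; last first.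
  exists la => i; have := congr1 (fun h : 'Hom(V, F^o) => h (e i)) gq.
  rewrite scale_lfunE gE (bigD1 i) //= pe eqxx mulr1 big1 ?addr0 // => k /negPf ki.
  by rewrite pe ki mulr0.
apply/subvP => w wq; rewrite memv_ker gE; apply/eqP.
rewrite -[RHS](q_weights b0 wq); under [RHS]eq_bigr do rewrite mulrCA.
rewrite bE (form_coord (p j)) mulr_sumr -sumrB; apply: eq_bigr => i _.
by ring.
Qed.

(** Two points p j and p l outside the coordinate ones suffice. By
    weight_eq, a coincidence between the nodes of i and k, or sigma j = sigma l,
    makes a 2 x 2 minor of their coordinates vanish as soon as q does not vanish
    at e i and e k. *)
Lemma rational_normal_curve_many : (n.+1 < d)%N ->
  exists2 C, rational_normal_curve C & forall j, C (lker (p j)).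
Proof.
move=> nd; pose m i : F := q (e i).
have lam_neq0 (j : 'I_d) la : (n <= j)%N ->
    (forall i, p j (e i) * (sigma (iota i) - sigma j) = la * m i) -> la != 0.
  move=> nj E; apply/eqP => la0.
  have si i : sigma (iota i) = sigma j.
    have := E i; rewrite la0 mul0r => /eqP; rewrite mulf_eq0.
    by rewrite (negPf (coord_neq0 i nj)) subr_eq0 => /eqP.
  have [l sl] : exists l, sigma l != sigma j.
    case: sigma_nonconst => a [b ab]; case: (eqVneq (sigma a) (sigma j)) => [aj|].
      by exists b; rewrite -aj eq_sym.
    by exists a.
  have [[i li]|nl] := iota_or l; first by rewrite li si eqxx in sl.
  have [mu El] := weight_eq nl; have slj : sigma j - sigma l != 0.
    by rewrite subr_eq0 eq_sym.
  (* The weights of the coordinate forms all equal sigma j, so p l is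
     proportional to q, which is not among the points. *)
  have plq : (sigma j - sigma l) *: p l = mu *: q.
    apply: form_ext => i; rewrite !scale_lfunE.
    by have := El i; rewrite si mulrC.
  have mu0 : mu != 0.
    apply: contra_neq (p_neq0 l) => mu0; apply/eqP.
    by move/eqP: plq; rewrite mu0 scale0r scaler_eq0 (negPf slj).
  by apply: (q_new (j := l)); rewrite -(lkerZ _ mu0) -plq lkerZ.
have cross (j l : 'I_d) i k : (n <= j)%N -> (n <= l)%N -> j != l -> i != k ->
    m i != 0 -> m k != 0 ->
    (sigma (iota i) != sigma (iota k)) && (sigma j != sigma l).
  move=> nj nl jl ik mi mk; have [la Ej] := weight_eq nj.
  have [mu El] := weight_eq nl.
  have la0 := lam_neq0 _ _ nj Ej; have mu0 := lam_neq0 _ _ nl El.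
  have nz (h : 'I_d) ka g : ka != 0 -> m g != 0 ->
      p h (e g) * (sigma (iota g) - sigma h) = ka * m g ->
      sigma (iota g) - sigma h != 0.
    move=> ka0 mg E; have : ka * m g != 0 by rewrite mulf_neq0.
    by rewrite -E mulf_eq0 negb_or => /andP[].
  have ji := nz _ _ _ la0 mi (Ej i); have lk := nz _ _ _ mu0 mk (El k).
  have := minor_neq0 nj nl jl ik; apply: contraR; rewrite negb_and !negbK => h.
  apply/eqP/(mulIf (mulf_neq0 ji lk)).
  rewrite mulrACA Ej El.
  have -> : (sigma (iota i) - sigma j) * (sigma (iota k) - sigma l) =
            (sigma (iota k) - sigma j) * (sigma (iota i) - sigma l).
    by case/orP: h => /eqP ->; ring.
  by rewrite [RHS]mulrACA Ej El; ring.
have [i1 mi1] : exists i, m i != 0.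
  apply/existsP; apply: contraR q_neq0 => /existsPn h; apply/eqP/form_ext => i.
  by rewrite lfunE /=; apply/eqP; move: (h i); rewrite negbK.
(* Otherwise q would be proportional to the coordinate form of i1. *)
have [i2 /andP[i12 mi2]] : exists i, (i1 != i) && (m i != 0).
  apply/existsP; apply: contraT => /existsPn h.
  case: (@q_new (iota i1)); rewrite -(lkerZ (p (iota i1)) mi1); congr lker.
  apply: form_ext => i; rewrite scale_lfunE pe; have [<-|i1i] := eqVneq i1 i.
    exact: esym (mulr1 _).
  by rewrite scaler0; apply/eqP; have := h i; rewrite i1i negbK.
(* If m i = 0, then sigma j and sigma l both equal sigma (iota i), which cross
   excludes for the pair i1, i2. *)
have m0 i : m i != 0.
  pose j : 'I_d := Ordinal (ltnW nd); pose l : 'I_d := Ordinal nd.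
  have jl : j != l by rewrite -val_eqE /= ltn_eqF.
  have nl : (n <= l)%N by rewrite /= leqnSn.
  apply/eqP => mi0; have /andP[_] := cross j l i1 i2 (leqnn n) nl jl i12 mi1 mi2.
  have si (h : 'I_d) : (n <= h)%N -> sigma (iota i) = sigma h.
    move=> nh; have [la E] := weight_eq nh; have := E i; rewrite -/(m i) mi0 mulr0.
    by move/eqP; rewrite mulf_eq0 (negPf (coord_neq0 i nh)) subr_eq0 => /eqP.
  by rewrite -(si j) // -(si l) // eqxx.
apply: (rational_normal_curve_pencil (sigma := sigma \o iota) (m := m)) => //.
  move=> i k /= sik; apply/eqP/negPn/negP => ik.
  pose j : 'I_d := Ordinal (ltnW nd); pose l : 'I_d := Ordinal nd.
  have jl : j != l by rewrite -val_eqE /= ltn_eqF.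
  have nl : (n <= l)%N by rewrite /= leqnSn.
  by have /andP[] := cross j l i k (leqnn n) nl jl ik (m0 i) (m0 k); rewrite sik eqxx.
move=> j nj; have [la E] := weight_eq nj; exists (sigma j), la.
by split; [exact: lam_neq0 E | exact: E].
Qed.

End Weights.

End GeneralPosition.

(** * Points of the Valles locus *)

Local Open Scope classical_set_scope.

Theorem propositionA1 (R : realType) (r d : nat) (V : vectType R[i])
    (X : {fset {vspace V}}) :
  \dim {:V} = r.+1 -> (3 <= r)%N ->
  [set` X] `<=` @hyperplane _ V ->
  #|` X|%fset = d -> (r.+1 <= d)%N ->
  linear_general_position X ->
  [set` X] `<` Valles (dolgachev_kapranov [set` X]) ->
  exists2 C : set {vspace V}, rational_normal_curve C & [set` X] `<=` C.
Proof.
move=> dimV r3 hypX cardX rd gpX [_ /existsNP[W0 /not_implyP[[hW0 W0unst] W0X]]].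
have XjP (j : 'I_d) : nth 0%VS X j \in X.
  by apply: mem_nth; rewrite [X in (_ < X)%N]cardX.
have /choice[p hp] : forall j : 'I_d, exists q : 'Hom(V, R[i]^o),
    q != 0 /\ nth 0%VS X j = lker q.
  by move=> j; have [q] := hyperplane_lker (hypX _ (XjP j)); exists q.
have p_neq0 j : p j != 0 by case: (hp j).
have p_inj : injective (fun j => lker (p j)).
  move=> j l; rewrite -(hp j).2 -(hp l).2 => /eqP.
  by rewrite nth_uniq ?cardX ?fset_uniq // => /eqP/val_inj.
have Xp W : [set` X] W <-> exists j, W = lker (p j).
  split=> [|[j ->] /=]; last by rewrite -(hp j).2.
  move=> /= WX; have jd : (index W X < d)%N by rewrite -cardX index_mem.
  by exists (Ordinal jd); rewrite -(hp _).2 nth_index.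
have nd : (\dim {:V} <= d)%N by rewrite dimV.
have n2 : (2 < \dim {:V})%N by rewrite dimV ltnS ltnW.
have gp (J : {set 'I_d}) v :
    #|J| = \dim {:V} -> {in J, forall j, p j v = 0} -> v = 0.
  move=> cJ Jv; pose Y := [fset lker (p j) | j in J]%fset.
  have cY : #|` Y|%fset = \dim {:V} by rewrite card_imfset //= -cardE.
  have YX : (Y `<=` X)%fset.
    by apply/fsubsetP => _ /imfsetP[j _ ->]; apply/Xp; exists j.
  have := gpX Y YX; rewrite cY leqnn => /(_ isT) /eqP.
  rewrite -[X in _ == X]add0n eqn_add2r dimv_eq0 => /eqP cap0.
  apply/eqP; rewrite -memv0 -cap0; apply: memv_bigcap_seq => _ /imfsetP[j Jj ->].
  by rewrite memv_ker Jv.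
have [e [pe e_span]] := dual_basis nd gp.
suff [C hC CP] : exists2 C, rational_normal_curve C & forall j, C (lker (p j)).
  by exists C => // _ /Xp[j ->].
have [dn|dn] := leqP d (\dim {:V}).+1.
  exact: (rational_normal_curve_few gp pe dn).
have [q q0 W0E] := hyperplane_lker hW0.
have d1 : (1 < d)%N by apply: leq_trans (ltnW n2) nd.
have [sigma sn sw] := unstable_weights n2 d1 p_neq0 p_inj Xp hW0 W0unst.
apply: (rational_normal_curve_many p_neq0 gp pe e_span sn q0 _ _ dn).
  by move=> j qj; apply: W0X; apply/Xp; exists j; rewrite W0E.
by rewrite -W0E.
Qed.
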